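(* Let $X$ and $Y$ be two connected CW-complexes and let $f$ be a morphism of globular CW-complexes from $\mathrm{Glob}(X)$ to $\mathrm{Glob}(Y)$. If $f$ is a weak S-homotopy equivalence, then there exists a morphism of globular CW-complexes $g$ from $\mathrm{Glob}(Y)$ to $\mathrm{Glob}(X)$ such that $g\circ f$ is S-homotopic to the identity of $\mathrm{Glob}(X)$ and $f\circ g$ is S-homotopic to the identity of $\mathrm{Glob}(Y)$.
   Context: For a topological space $X$, $\mathrm{Glob}(X)$ is the quotient of $X\times[0,1]$ by $(x,0)=(x',0)$ and $(x,1)=(x',1)$ for all $x,x'\in X$; the class of $(x,0)$ is $\underline\iota$ and that of $(x,1)$ is $\underline\sigma$. It is partially ordered by the image of $\{((x,t),(x,t')) : t\le t'\}$. If $X$ is a CW-complex, $\mathrm{Glob}(X)$ is a globular CW-complex with $0$-skeleton $\{\underline\iota,\underline\sigma\}$. The non-constant execution paths of $\mathrm{Glob}(X)$ are the continuous non-decreasing maps $\gamma:[0,1]\to\mathrm{Glob}(X)$ with $\gamma(0)=\underline\iota$ and $\gamma(1)=\underline\sigma$. A morphism of globular CW-complexes $f:\mathrm{Glob}(X)\to\mathrm{Glob}(Y)$ is a continuous map with $f(\{\underline\iota,\underline\sigma\})\subset\{\underline\iota,\underline\sigma\}$ such that $f\circ\gamma$ is a non-constant execution path for every non-constant execution path $\gamma$. Two such morphisms $f,g$ are S-homotopic if there is a continuous $H:\mathrm{Glob}(X)\times[0,1]\to\mathrm{Glob}(Y)$ with $H(-,0)=f$, $H(-,1)=g$ and each $H(-,u)$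 a morphism of globular CW-complexes. For $\alpha,\beta$ in the $0$-skeleton, $\mathbb P(\mathrm{Glob}(X),\alpha,\beta)$ is the set of non-constant execution paths from $\alpha$ to $\beta$, with the Kelleyfication of the compact-open topology (so it is empty unless $(\alpha,\beta)=(\underline\iota,\underline\sigma)$). The Kelleyfication $k(Z)$ of a Hausdorff space $Z$ is the direct limit of its compact subspaces. A morphism $f$ is a weak S-homotopy equivalence if it induces a bijection between the $0$-skeletons and, for all $\alpha,\beta$ in the $0$-skeleton, $\gamma\mapsto f\circ\gamma$ is a weak homotopy equivalence $\mathbb P(\mathrm{Glob}(X),\alpha,\beta)\to\mathbb P(\mathrm{Glob}(Y),f(\alpha),f(\beta))$. *)

(* Defs.v *)
From HB Require Import structures.
From mathcomp Require Import all_boot all_order all_algebra generic_quotient.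
From mathcomp Require Import all_classical reals topology.

Set Implicit Arguments.
Unset Strict Implicit.
Unset Printing Implicit Defensive.

Import Order.TTheory GRing.Theory Num.Theory.
Import numFieldTopology.Exports.

Local Open Scope classical_set_scope.
Local Open Scope ring_scope.
Local Open Scope quotient_scope.

Section UnitInterval.
Variable R : realType.

Definition unit_interval : set R := `[0, 1]%classic.

Lemma unit_interval0 : 0 \in unit_interval.
Proof. by rewrite inE /unit_interval /= in_itv /= lexx ler01. Qed.

Lemma unit_interval1 : 1 \in unit_interval.
Proof. by rewrite inE /unit_interval /= in_itv /= lexx ler01. Qed.

Definition I0 : unit_interval := exist _ 0 unit_interval0.
Definition I1 : unit_interval := exist _ 1 unit_interval1.

End UnitInterval.

Arguments unit_interval R : clear implicits.
Arguments I0 {R}.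
Arguments I1 {R}.

(* The norm of 'rV[R]_n in the library is the sup norm, whence the explicit
   sum of squares; the topology is in any case the product topology. *)
Section CWComplex.
Variable R : realType.

Definition sqnorm (n : nat) (v : 'rV[R]_n) : R := \sum_(i < n) v ord0 i ^+ 2.

Definition disk (n : nat) : set 'rV[R]_n := [set v | sqnorm v <= 1].
Arguments disk n : clear implicits.

Definition disk_interior (n : nat) : set (disk n) :=
  [set v | sqnorm (set_val v) < 1].
Arguments disk_interior n : clear implicits.

Definition disk_boundary (n : nat) : set (disk n) :=
  [set v | sqnorm (set_val v) = 1].
Arguments disk_boundary n : clear implicits.

(* Whitehead's definition: Phi j is the characteristic map of the j-th cell,
   which has dimension d j. *)
Definition open_cell (X : topologicalType) (J : Type) (d : J -> nat)
    (Phi : forall j, disk (d j) -> X) (j : J) : set X :=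
  Phi j @` disk_interior (d j).

Definition is_cw_structure (X : topologicalType) (J : Type) (d : J -> nat)
    (Phi : forall j, disk (d j) -> X) : Prop :=
  [/\ forall j, continuous (Phi j),
      (* each Phi j restricts to a homeomorphism from the open disk onto the
         open cell *)
      forall j, set_inj (disk_interior (d j)) (Phi j) /\
        forall U : set (disk (d j)), open U ->
          exists2 V : set X, open V &
            Phi j @` (U `&` disk_interior (d j)) = V `&` open_cell Phi j,
      partition [set: J] (open_cell Phi) [set: X],
      forall j, exists F : set J, [/\ finite_set F,
        forall i, F i -> (d i < d j)%N &
        Phi j @` disk_boundary (d j) `<=` \bigcup_(i in F) open_cell Phi i] &
      forall A : set X, (forall j, closed (Phi j @^-1` A)) -> closed A].

Definition cw_complex (X : topologicalType) : Prop :=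
  hausdorff_space X /\
  exists (J : Type) (d : J -> nat) (Phi : forall j, disk (d j) -> X),
    is_cw_structure Phi.

End CWComplex.

Arguments disk R n : clear implicits.
Arguments disk_interior R n : clear implicits.
Arguments disk_boundary R n : clear implicits.

Definition kelley (Z : topologicalType) : Type := Z.

Section Kelleyfication.
Variable Z : topologicalType.

HB.instance Definition _ := Choice.on (kelley Z).

(* The topology of the direct limit of the compact subspaces of Z: the final
   topology for the inclusions of the compact subspaces. *)
Definition kelley_open (U : set (kelley Z)) : Prop :=
  forall K : set Z, compact K ->
    open ((set_val : K -> Z) @^-1` (U : set Z)).

Lemma kelley_openT : kelley_open setT.
Proof. by move=> K _; rewrite preimage_setT; exact: openT. Qed.

Lemma kelley_openI (A B : set (kelley Z)) :
  kelley_open A -> kelley_open B -> kelley_open (A `&` B).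
Proof.
by move=> oA oB K cK; rewrite preimage_setI; apply: openI; [exact: oA|exact: oB].
Qed.

Lemma kelley_open_bigU (I : Type) (f : I -> set (kelley Z)) :
  (forall i, kelley_open (f i)) -> kelley_open (\bigcup_i f i).
Proof.
by move=> of_ K cK; rewrite preimage_bigcup; apply: bigcup_open => i _; exact: of_.
Qed.

HB.instance Definition _ := isOpenTopological.Build (kelley Z)
  kelley_openT kelley_openI kelley_open_bigU.

End Kelleyfication.

Section WeakHomotopyEquivalence.
Variable R : realType.
Local Notation I := (unit_interval R).

Definition joined_by_path (Z : topologicalType) (a b : Z) : Prop :=
  exists p : I -> Z, [/\ continuous p, p I0 = a & p I1 = b].

Definition cube (n : nat) : set 'rV[R]_n :=
  [set v | forall i, 0 <= v ord0 i <= 1].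
Arguments cube n : clear implicits.

Definition cube_boundary (n : nat) : set (cube n) :=
  [set v | exists i, (set_val v : 'rV[R]_n) ord0 i = 0 \/
                     (set_val v : 'rV[R]_n) ord0 i = 1].

(* Maps of pairs (cube, boundary) -> (Z, z), whose homotopy classes relative to
   the boundary are the elements of the n-th homotopy group of (Z, z). *)
Definition is_spheroid (n : nat) (Z : topologicalType) (z : Z)
    (g : cube n -> Z) : Prop :=
  continuous g /\ forall v, cube_boundary v -> g v = z.

Definition spheroid_homotopic (n : nat) (Z : topologicalType) (z : Z)
    (g g' : cube n -> Z) : Prop :=
  exists H : cube n * I -> Z,
    [/\ continuous H,
        forall v, H (v, I0) = g v,
        forall v, H (v, I1) = g' v &
        forall v t, cube_boundary v -> H (v, t) = z].

(* The two conjuncts say that [g] |-> [phi \o g] is injective, resp.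
   surjective, on homotopy classes.  For n > 0 this map is automatically a
   morphism of groups, so that bijective is the same as isomorphism. *)
Definition pi_bijective (n : nat) (Z W : topologicalType) (phi : Z -> W)
    (z : Z) : Prop :=
  (forall g g' : cube n -> Z, is_spheroid z g -> is_spheroid z g' ->
     spheroid_homotopic (phi z) (phi \o g) (phi \o g') ->
     spheroid_homotopic z g g') /\
  (forall h : cube n -> W, is_spheroid (phi z) h ->
     exists2 g : cube n -> Z, is_spheroid z g &
       spheroid_homotopic (phi z) (phi \o g) h).

(* No base point is involved here, so that Z and W may be empty. *)
Definition pi0_bijective (Z W : topologicalType) (phi : Z -> W) : Prop :=
  (forall a b : Z, joined_by_path (phi a) (phi b) -> joined_by_path a b) /\
  (forall w : W, exists a : Z, joined_by_path (phi a) w).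

Definition weak_homotopy_equivalence (Z W : topologicalType) (phi : Z -> W) :
    Prop :=
  [/\ continuous phi,
      pi0_bijective phi &
      forall (n : nat) (z : Z), (0 < n)%N -> pi_bijective n phi z].

End WeakHomotopyEquivalence.

Arguments cube R n : clear implicits.

Section GlobDef.
Variables (R : realType) (X : topologicalType).

Definition glob_rel (p q : X * unit_interval R) : bool :=
  [|| p == q,
      (p.2 == I0) && (q.2 == I0) |
      (p.2 == I1) && (q.2 == I1)].

Lemma glob_rel_refl : reflexive glob_rel.
Proof. by move=> p; rewrite /glob_rel eqxx. Qed.

Lemma glob_rel_sym : symmetric glob_rel.
Proof.
move=> p q; rewrite /glob_rel [q == p]eq_sym.
by rewrite [(q.2 == I0) && _]andbC [(q.2 == I1) && _]andbC.
Qed.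

Lemma I0_neq_I1 : (I0 : unit_interval R) != I1.
Proof.
by apply/eqP => /(congr1 set_val) /= /eqP; rewrite eq_sym oner_eq0.
Qed.

Lemma glob_rel_trans : transitive glob_rel.
Proof.
have I01 := negbTE I0_neq_I1.
move=> q p r; rewrite /glob_rel => /or3P[/eqP -> //|/andP[p0 q0]|/andP[p1 q1]].
  move=> /or3P[/eqP <-|/andP[_ r0]|/andP[]].
  - by rewrite p0 q0 orbT.
  - by rewrite p0 r0 orbT.
  - by rewrite (eqP q0) I01.
move=> /or3P[/eqP <-|/andP[]|/andP[_ r1]].
- by rewrite p1 q1 !orbT.
- by rewrite (eqP q1) eq_sym I01.
- by rewrite p1 r1 !orbT.
Qed.

Definition glob_equiv := EquivRel _ glob_rel_refl glob_rel_sym glob_rel_trans.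

Definition Glob := {eq_quot glob_equiv}.

HB.instance Definition _ := Topological.copy Glob (quotient_topology Glob).
HB.instance Definition _ := Quotient.on Glob.

Definition glob_class (x : X) (t : unit_interval R) : Glob := \pi_Glob (x, t).

(* iota and sigma are the singletons of the two end points (and are empty when
   X is); they are sets because X comes with no distinguished point. *)
Definition iota : set Glob := [set glob_class x I0 | x in [set: X]].
Definition sigma : set Glob := [set glob_class x I1 | x in [set: X]].
Definition skeleton0 : set Glob := iota `|` sigma.

Definition glob_le (a b : Glob) : Prop :=
  exists x (t t' : unit_interval R),
    [/\ set_val t <= set_val t', a = glob_class x t & b = glob_class x t'].

Definition exec_path (gamma : unit_interval R -> Glob) : Prop :=
  [/\ continuous gamma,
      forall s s' : unit_interval R,
        set_val s <= set_val s' -> glob_le (gamma s) (gamma s'),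
      iota (gamma I0) & sigma (gamma I1)].

Definition exec_path_set (alpha beta : Glob) :
    set {compact-open, unit_interval R -> Glob} :=
  [set gamma | [/\ exec_path gamma,
                   (gamma : unit_interval R -> Glob) I0 = alpha &
                   (gamma : unit_interval R -> Glob) I1 = beta]].

(* exec_path_set is coerced to a type, with the subspace topology. *)
Definition exec_path_space (alpha beta : Glob) : topologicalType :=
  kelley (exec_path_set alpha beta).

End GlobDef.

Section Morphisms.
Variable R : realType.
Implicit Types X Y : topologicalType.

Definition is_glob_morphism X Y (f : Glob R X -> Glob R Y) : Prop :=
  [/\ continuous f,
      f @` @skeleton0 R X `<=` @skeleton0 R Y &
      forall gamma, exec_path gamma -> exec_path (f \o gamma)].

Record glob_morphism X Y := GlobMorphism {
  glob_morphism_fun :> Glob R X -> Glob R Y;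
  glob_morphismP : is_glob_morphism glob_morphism_fun }.

Definition S_homotopic X Y (f g : Glob R X -> Glob R Y) : Prop :=
  exists H : Glob R X * unit_interval R -> Glob R Y,
    [/\ continuous H,
        forall z, H (z, I0) = f z,
        forall z, H (z, I1) = g z &
        forall u, is_glob_morphism (fun z => H (z, u))].

Lemma exec_path_set_comp X Y (f : glob_morphism X Y) (alpha beta : Glob R X)
    (gamma : unit_interval R -> Glob R X) :
  exec_path_set alpha beta gamma ->
  exec_path_set (f alpha) (f beta) (f \o gamma).
Proof.
case: f => f [cf sf pf] [/= pg <- <-]; split => //.
exact: pf.
Qed.

Definition exec_path_map X Y (f : glob_morphism X Y) (alpha beta : Glob R X) :
    exec_path_space alpha beta -> exec_path_space (f alpha) (f beta) :=
  fun gamma : exec_path_set alpha beta =>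
    exist _ (f \o set_val gamma)
      (mem_set (exec_path_set_comp f (set_mem (valP gamma)))).

Definition weak_S_homotopy_equivalence X Y (f : glob_morphism X Y) : Prop :=
  set_bij (@skeleton0 R X) (@skeleton0 R Y) f /\
  forall alpha beta, skeleton0 alpha -> skeleton0 beta ->
    weak_homotopy_equivalence R (@exec_path_map X Y f alpha beta).

End Morphisms.

(* Main.v *)
Require Import Defs.
From mathcomp Require Import all_boot all_order all_algebra all_classical reals.
From mathcomp Require Import topology normedtype realfun generic_quotient ring lra.

Set Implicit Arguments.
Unset Strict Implicit.
Unset Printing Implicit Defensive.

Import Order.TTheory GRing.Theory Num.Theory.
Import numFieldTopology.Exports numFieldNormedType.Exports.

Local Open Scope classical_set_scope.
Local Open Scope ring_scope.

(* A morphism f of globes is f (x, t) = (h x, phi x t), where h is continuous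
   and phi x is a nondecreasing reparametrisation of [0, 1]: an execution path
   keeps its base point while its height is neither 0 nor 1.  The space of
   execution paths of Glob X is X times a convex set of reparametrisations, so
   that f being a weak S-homotopy equivalence makes h a weak homotopy
   equivalence.  Whitehead's theorem gives a homotopy inverse k of h; the globe
   of k is the required g, the reparametrisations being interpolated linearly.

   Whitehead's theorem is obtained from one lifting property: a map b from a
   disk to Y, together with a lift through h, up to homotopy, on the boundary
   sphere, has a lift up to homotopy extending the given data.  It is proved on
   cubes.  Lifting problems that are homotopic are solvable together, because
   cubes and prisms over cubes have the homotopy extension property.  Boundary
   values can thus be made constant on all faces but one, where injectivity on
   the homotopy groups extends them to the cube; contracting the extension
   leaves a spheroid, which is lifted by surjectivity.  Induction over the
   skeleta of Y gives k with h o k homotopic to the identity, and induction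
   over those of X, with prisms instead of disks, gives the other homotopy. *)

(** * Continuity on subsets and in function spaces *)

Section GeneralTopology.
Implicit Types T U V : topologicalType.

Lemma continuous_pair T U V (f : T -> U) (g : T -> V) :
  continuous f -> continuous g -> continuous (fun t => (f t, g t)).
Proof. by move=> cf cg t; apply: cvg_pair; [exact: cf|exact: cg]. Qed.

Lemma continuous_fst U V : continuous (@fst U V).
Proof. by move=> x; exact: cvg_fst. Qed.

Lemma continuous_snd U V : continuous (@snd U V).
Proof. by move=> x; exact: cvg_snd. Qed.

Lemma continuous_comp_fun T U V (g : U -> V) (f : T -> U) :
  continuous g -> continuous f -> continuous (g \o f).
Proof. by move=> cg cf t; apply: continuous_comp; [exact: cf|exact: cg]. Qed.

Lemma continuous_set_val T (A : set T) : continuous (set_val : A -> T).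
Proof. exact: initial_continuous. Qed.

Lemma continuous_to_set_type T U (A : set U) (f : T -> A) :
  continuous (fun t => set_val (f t)) -> continuous f.
Proof. exact: continuous_comp_initial. Qed.

Lemma within_comp T U V (A : set T) (B : set U) (f : T -> U) (g : U -> V) :
  {within A, continuous f} -> (forall t, A t -> B (f t)) ->
  {within B, continuous g} -> {within A, continuous (g \o f)}.
Proof.
move=> /subspace_continuousP cf AB /subspace_continuousP cg.
apply/subspace_continuousP => t At W /(cg _ (AB _ At)) /= gW.
have /= := cf _ At _ gW; rewrite /within /=.
by apply: filterS2 (withinT A _) => s As; apply; exact: AB.
Qed.

Lemma within_comp_continuous T U V (B : set U) (f : T -> U) (g : U -> V) :
  continuous f -> (forall t, B (f t)) ->
  {within B, continuous g} -> continuous (g \o f).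
Proof.
move=> cf fB cg; apply/continuous_subspace_setT.
by apply: (@within_comp _ _ _ setT B) => //; exact: continuous_subspaceT.
Qed.

Lemma within_eq T U (A : set T) (f g : T -> U) :
  (forall t, A t -> f t = g t) ->
  {within A, continuous f} -> {within A, continuous g}.
Proof.
by move=> fg; apply: subspace_eq_continuous => t /set_mem At; exact: fg.
Qed.

(** A filter on the subtype is pushed forward to [T]. Its cluster point lies in [A], and it is a
    cluster point of the original filter because open sets of the subtype are traces of open sets of
    [T]. *)
Lemma compact_set_type T (A : set T) : compact A -> compact [set: A].
Proof.
move=> cA F FF _.
have GF : ProperFilter (set_val @ F : set_system T) by exact: fmap_proper_filter.
have [|x [Ax clx]] := cA (set_val @ F) GF.
  by rewrite /= /fmap /=; apply: filterS (@filterT _ F _) => x _; exact: set_valP.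
exists (exist _ x (mem_set Ax)); split=> // P Q FP.
rewrite nbhsE => -[O [[O' oO' <-] Ox] OQ].
have [] := clx (set_val @` P) O'.
- by rewrite /= /fmap /=; apply: filterS FP => y Py; exists y.
- by apply: open_nbhs_nbhs; split.
by move=> _ [[y Py <-] O'y]; exists y; split=> //; exact: OQ.
Qed.

Lemma hausdorff_set_type T (A : set T) :
  hausdorff_space T -> hausdorff_space A.
Proof.
move=> hT x y xy; apply: val_inj; apply: hT => P Q Px Qy.
have [||z [Pz Qz]] := xy (set_val @^-1` P) (set_val @^-1` Q).
- exact: continuous_set_val.
- exact: continuous_set_val.
by exists (set_val z).
Qed.

End GeneralTopology.

Section Currying.
Context {U V W : topologicalType}.

Lemma continuous_uncurry_compact (f : U -> {compact-open, V -> W}) :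
  compact [set: V] -> hausdorff_space V -> continuous f ->
  (forall u, continuous (f u : V -> W)) ->
  continuous (fun z : U * V => (f z.1 : V -> W) z.2).
Proof.
move=> cV hV cf cfu.
have lcV : locally_compact [set: V].
  move=> v _; exists setT; first by rewrite withinET; exact: filterT.
  by split=> //; exact: closedT.
have := @continuous_uncurry U V W f lcV hV cf cfu.
by rewrite (_ : uncurry _ = fun z : U * V => (f z.1 : V -> W) z.2)//; apply/funext => -[].
Qed.

Lemma continuous_curry_compact_open (f : U * V -> W) :
  continuous f ->
  continuous ((fun u v => f (u, v)) : U -> {compact-open, V -> W}).
Proof. exact: continuous_curry_fun. Qed.

Lemma continuous_slice (f : U * V -> W) u :
  continuous f -> continuous (fun v => f (u, v)).
Proof.
move=> cf; apply: (@continuous_comp_fun _ _ _ f (fun v => (u, v))) => //.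
by apply: continuous_pair; [exact: cst_continuous|move=> x; exact: cvg_id].
Qed.

End Currying.

(** Uncurrying is applied over the space [subspace A], whose neighbourhoods at points of [A] are the
    relative ones. *)
Lemma within_uncurry_compact (U V W : topologicalType) (A : set U)
    (f : U -> {compact-open, V -> W}) :
  compact [set: V] -> hausdorff_space V -> {within A, continuous f} ->
  (forall u, A u -> continuous (f u : V -> W)) ->
  {within A `*` setT, continuous (fun z : U * V => (f z.1 : V -> W) z.2)}.
Proof.
move=> cV hV cf cfu; have [A0|/set0P[u0 Au0]] := eqVneq A set0.
  by rewrite A0 set0X; exact: continuous_subspace0.
(* Uncurrying asks every value to be continuous in [V]; outside [A], the value at a fixed point of
   [A] is substituted. *)
pose g u : {compact-open, V -> W} := if `[< A u >] then f u else f u0.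
have gE u : A u -> g u = f u by move=> Au; rewrite /g asboolT.
apply: (@within_eq _ _ _ (fun z : U * V => (g z.1 : V -> W) z.2)).
  by move=> [u v] [/= Au _]; rewrite gE.
have cg : continuous (g : subspace A -> _).
  by apply: (within_eq _ cf) => u Au; rewrite gE.
have := @continuous_uncurry_compact (subspace A) V W g cV hV cg.
have cgu u : continuous (g u : V -> W).
  by rewrite /g; case: asboolP => [/cfu//|_]; exact: cfu.
move=> /(_ cgu) cG.
apply/subspace_continuousP => -[u v] [/= Au _] P /(cG (u, v)) /=.
case=> -[/= P1 P2] [nP1 nP2] PP; rewrite /within /=.
have : nbhs u (fun x => A x -> P1 x).
  by move: nP1; rewrite {1}/nbhs /= -(nbhs_subspace_in Au).
move=> nP1'; exists ((fun x => A x -> P1 x), P2); first by split.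
by move=> [x y] [/= h1 h2] [Ax _]; apply: (PP (x, y)); split => //=; exact: h1.
Qed.

(** * The unit interval and convex combinations *)

Section UnitIntervalTheory.
Variable R : realType.
Local Notation I := (unit_interval R).

Lemma unit_interval_bounds (t : I) : 0 <= set_val t <= 1.
Proof. by have := set_valP t; rewrite /unit_interval /= in_itv. Qed.

Lemma unit_interval_inj (s t : I) : set_val s = set_val t -> s = t.
Proof. exact: val_inj. Qed.

Lemma I0E : set_val (I0 : I) = 0. Proof. by []. Qed.
Lemma I1E : set_val (I1 : I) = 1. Proof. by []. Qed.

Lemma compact_unit_interval : compact [set: I].
Proof. by apply: compact_set_type; exact: segment_compact. Qed.

Lemma hausdorff_unit_interval : hausdorff_space I.
Proof. by apply: hausdorff_set_type; exact: Rhausdorff. Qed.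

Lemma closed_unit_interval1 (t : I) : closed [set t].
Proof.
apply: accessible_closed_set1; apply: hausdorff_accessible.
exact: hausdorff_unit_interval.
Qed.

Lemma clamp_subproof (x : R) : unit_interval R (Num.max 0 (Num.min 1 x)).
Proof.
rewrite /unit_interval /= in_itv /= le_max lexx /=.
by rewrite ge_max ler01 ge_min lexx.
Qed.

(** A retraction of the line onto the interval: real formulas define points of [I] at once, and
    their bounds are checked only when the value is computed by [clampE]. *)
Definition clamp (x : R) : I := exist _ (Num.max 0 (Num.min 1 x)) (mem_set (clamp_subproof x)).

Lemma clampE (x : R) : 0 <= x <= 1 -> set_val (clamp x) = x.
Proof. by move=> /andP[x0 x1]; rewrite set_valE /= (min_r x1) (max_r x0). Qed.

Lemma continuous_clamp : continuous clamp.
Proof.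
apply: continuous_to_set_type => x; apply: continuous_max; first exact: cvg_cst.
by apply: continuous_min; [exact: cvg_cst|exact: cvg_id].
Qed.

(** Clamping only supplies the membership proof, since a convex combination already lies in the
    interval. *)
Definition mix (u a b : I) : I :=
  clamp ((1 - set_val u) * set_val a + set_val u * set_val b).

Lemma mixE (u a b : I) :
  set_val (mix u a b) = (1 - set_val u) * set_val a + set_val u * set_val b.
Proof.
rewrite clampE//.
move: (unit_interval_bounds u) (unit_interval_bounds a) (unit_interval_bounds b).
by move=> /andP[? ?] /andP[? ?] /andP[? ?]; apply/andP; split; nra.
Qed.

Lemma continuous_mix (T : topologicalType) (u a b : T -> I) :
  continuous u -> continuous a -> continuous b ->
  continuous (fun t => mix (u t) (a t) (b t)).
Proof.
move=> cu ca cb; have cv (f : T -> I) : continuous f -> continuous (set_val \o f).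
  by move=> cf; apply: continuous_comp_fun cf; exact: continuous_set_val.
apply: (@continuous_comp_fun _ _ _ clamp); first exact: continuous_clamp.
move=> t; apply: cvgD; apply: cvgM; try exact: cv.
by apply: cvgB; [exact: cvg_cst|exact: cv].
Qed.

Lemma mix0 a b : mix I0 a b = a.
Proof. by apply: unit_interval_inj; rewrite mixE I0E; ring. Qed.

Lemma mix1 a b : mix I1 a b = b.
Proof. by apply: unit_interval_inj; rewrite mixE I1E; ring. Qed.

Lemma mixxx u a : mix u a a = a.
Proof. by apply: unit_interval_inj; rewrite mixE; ring. Qed.

Lemma mix01 u : mix u I0 I1 = u.
Proof. by apply: unit_interval_inj; rewrite mixE I0E I1E; ring. Qed.

End UnitIntervalTheory.

(** * Pasting and the homotopy extension property *)

Section Pairs.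
Variable R : realType.
Local Notation I := (unit_interval R).
Implicit Types B T : topologicalType.

Lemma continuous_cst_fun T B (b : B) : continuous (fun _ : T => b).
Proof. exact: cst_continuous. Qed.

Definition revI (t : I) : I := mix t I1 I0.

Lemma revI0 : revI I0 = I1. Proof. exact: mix0. Qed.
Lemma revI1 : revI I1 = I0. Proof. exact: mix1. Qed.

Lemma continuous_revI : continuous revI.
Proof.
apply: continuous_mix; try exact: continuous_cst_fun.
by move=> x; exact: cvg_id.
Qed.

Lemma closed_fiber T (f : T -> I) (t : I) :
  continuous f -> closed [set x | f x = t].
Proof.
by move=> /continuous_closedP cf; apply: (cf [set t]); exact: closed_unit_interval1.
Qed.

Lemma closed_cylinder B T (A : set B) (f : T -> B) :
  continuous f -> closed A -> closed [set x | A (f x)].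
Proof. by move=> /continuous_closedP cf cA; exact: (cf A cA). Qed.

Lemma within_glue T B (C D : set T) (f g h : T -> B) :
  closed C -> closed D ->
  {within C, continuous f} -> {within D, continuous g} ->
  (forall x, C x -> h x = f x) -> (forall x, D x -> h x = g x) ->
  {within C `|` D, continuous h}.
Proof.
move=> cC cD cf cg hf hg; apply: withinU_continuous => //.
- by apply: (within_eq _ cf) => x /hf.
- by apply: (within_eq _ cg) => x /hg.
Qed.

(** A retraction of the cylinder onto its bottom together with its part over [A]: for closed [A],
    the classical criterion for the homotopy extension property. *)
Definition is_hep_retraction B (A : set B) (r : B * I -> B * I) :=
  [/\ continuous r,
      forall x, A (r x).1 \/ (r x).2 = I0 &
      forall x, A x.1 \/ x.2 = I0 -> r x = x].

Definition hep B (A : set B) := exists r, is_hep_retraction A r.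

(** The data on the bottom and over [A] are pasted along these two closed sets, then composed with
    the retraction. *)
Lemma hep_extend B (A : set B) : closed A -> hep A ->
  forall (Z : topologicalType) (g : B -> Z) (q : B * I -> Z), continuous g ->
    {within A `*` setT, continuous q} ->
    (forall b, A b -> q (b, I0) = g b) ->
  exists W : B * I -> Z, [/\ continuous W, forall b, W (b, I0) = g b &
    forall b t, A b -> W (b, t) = q (b, t)].
Proof.
move=> cA [r [cr rA rE]] Z g q cg cq gq.
pose w (x : B * I) := if x.2 == I0 then g x.1 else q x.
have wq b t : A b -> w (b, t) = q (b, t).
  by move=> Ab; rewrite /w /=; case: eqP => // ->; rewrite gq.
exists (w \o r); split.
- apply: (@within_comp_continuous _ _ _ ([set x | x.2 = I0] `|` (A `*` setT))) => //.
    by move=> x; have [Ax|] := rA x; [right; split|left].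
  apply: (within_glue _ _ (_ : {within _, continuous (g \o fst)}) cq).
  + by apply: closed_fiber; exact: continuous_snd.
  + rewrite setXT; apply: closed_cylinder => //; exact: continuous_fst.
  + apply: continuous_subspaceT; apply: continuous_comp_fun => //.
    exact: continuous_fst.
  + by move=> x /= x0; rewrite /w x0 eqxx.
  + by move=> [b t] [/= Ab _]; exact: wq.
- by move=> b; rewrite /= rE ?/w/= ?eqxx//; right.
- by move=> b t Ab; rewrite /= rE ?wq//; left.
Qed.

(** Reversing time reduces this to extension from the bottom. *)
Lemma hep_extend1 B (A : set B) : closed A -> hep A ->
  forall (Z : topologicalType) (g : B -> Z) (q : B * I -> Z), continuous g ->
    {within A `*` setT, continuous q} ->
    (forall b, A b -> q (b, I1) = g b) ->
  exists W : B * I -> Z, [/\ continuous W, forall b, W (b, I1) = g b &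
    forall b t, A b -> W (b, t) = q (b, t)].
Proof.
move=> cA hA Z g q cg cq gq.
have crev : continuous (fun x : B * I => (x.1, revI x.2)).
  apply: continuous_pair; first exact: continuous_fst.
  by apply: continuous_comp_fun; [exact: continuous_revI|exact: continuous_snd].
have revK (t : I) : revI (revI t) = t.
by apply: unit_interval_inj; rewrite !mixE I0E I1E; ring.
have [||W [cW W0 WA]] := hep_extend cA hA (q := q \o fun x => (x.1, revI x.2)) cg.
- apply: (within_comp _ _ cq); first exact: continuous_subspaceT.
  by move=> [b t] [].
- by move=> b Ab; rewrite /= revI0 gq.
exists (W \o fun x => (x.1, revI x.2)); split.
- exact: continuous_comp_fun.
- by move=> b; rewrite /= revI1 W0.
- by move=> b t Ab; rewrite /= WA//= revK.
Qed.

(** If [A] is the boundary of a cell [B], this is the boundary of the prism over it: the walls and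
    both ends. *)
Definition prism_boundary B (A : set B) : set (B * I) :=
  [set x | [\/ A x.1, x.2 = I0 | x.2 = I1]].

Lemma closed_prism_boundary B (A : set B) :
  closed A -> closed (prism_boundary A).
Proof.
move=> cA; rewrite (_ : prism_boundary A =
  [set x | A x.1] `|` [set x | x.2 = I0] `|` [set x | x.2 = I1]).
  apply: closedU; first apply: closedU.
  - by apply: closed_cylinder => //; exact: continuous_fst.
  - by apply: closed_fiber; exact: continuous_snd.
  - by apply: closed_fiber; exact: continuous_snd.
apply/seteqP; split=> x.
  by case=> ?; [left; left|left; right|right].
by case=> [[?|?]|?]; [constructor 1|constructor 2|constructor 3].
Qed.

End Pairs.

Arguments prism_boundary R {B} A.
Arguments hep R {B} A.

(** * Lifting problems and their homotopies *)

Definition contracts_to (R : realType) (B : topologicalType) (b0 : B)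
    (c : B * unit_interval R -> B) : Prop :=
  [/\ continuous c, forall b, c (b, I0) = b0 & forall b, c (b, I1) = b].

Section Lifting.
Variables (R : realType) (X Y : topologicalType) (h : X -> Y).
Hypothesis ch : continuous h.
Local Notation I := (unit_interval R).
Implicit Types B : topologicalType.

(** Over [A], both a lift [a] and a homotopy [p] from [h \o a] to [u] are prescribed. A solution
    extends them to a lift [a'] over [B] and a homotopy [G] from [h \o a'] to [u]. *)
Definition lifting_solution B (A : set B) (a : B -> X) (u : B -> Y)
    (p : B * I -> Y) : Prop :=
  exists a' G, [/\ continuous a', continuous G, forall b, A b -> a' b = a b,
    forall b, G (b, I0) = h (a' b) /\ G (b, I1) = u b &
    forall b t, A b -> G (b, t) = p (b, t)].

Definition has_lifting B (A : set B) : Prop :=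
  forall a u p, {within A, continuous a} -> continuous u ->
    {within A `*` setT, continuous p} ->
    (forall b, A b -> p (b, I0) = h (a b) /\ p (b, I1) = u b) ->
  lifting_solution A a u p.

(** The special case of a stationary homotopy over [A], where [u] agrees with [h \o a]. *)
Definition has_strict_lifting B (A : set B) : Prop :=
  forall a u, {within A, continuous a} -> continuous u ->
    (forall b, A b -> u b = h (a b)) ->
  lifting_solution A a u (u \o fst).

Lemma lifting_solution_eq B (A : set B) a u p a1 p1 :
  (forall b, A b -> a1 b = a b) ->
  (forall b t, A b -> p1 (b, t) = p (b, t)) ->
  lifting_solution A a u p -> lifting_solution A a1 u p1.
Proof.
move=> ea ep [a' [G [ca' cG a'a G01 Gp]]]; exists a', G; split=> //.
- by move=> b Ab; rewrite a'a ?ea.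
- by move=> b t Ab; rewrite Gp ?ep.
Qed.

(* Both the lift and the homotopy of the problem at time 0 are propagated along
   the family: first the lift over B x I, then the homotopy over the prism
   (B x I) x I. *)
Lemma lifting_solution_homotopy B (A : set B) (a : B * I -> X) (u : B * I -> Y)
    (p : B * I * I -> Y) :
  closed A -> hep R A -> hep R (prism_boundary R A) ->
  {within A `*` setT, continuous a} -> continuous u ->
  {within [set x | A x.1.1], continuous p} ->
  (forall b t, A b -> p (b, I0, t) = h (a (b, t)) /\ p (b, I1, t) = u (b, t)) ->
  lifting_solution A (fun b => a (b, I0)) (fun b => u (b, I0))
    (fun z => p (z, I0)) ->
  lifting_solution A (fun b => a (b, I1)) (fun b => u (b, I1))
    (fun z => p (z, I1)).
Proof.
move=> cA hA hpA ca cu cp p01 [a0 [G0 [ca0 cG0 a0a G0E G0p]]].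
have [|W [cW W0 WA]] := hep_extend cA hA ca0 ca.
  by move=> b Ab; rewrite a0a.
(* The homotopy on the boundary of the prism, in which the last coordinate is the time of the
   family: [h] of the extended lift at the bottom, [u] at the top, [p] over [A]. *)
pose w (x : B * I * I) := if x.1.2 == I0 then h (W (x.1.1, x.2))
  else if x.1.2 == I1 then u (x.1.1, x.2) else p x.
have w0 b t : w (b, I0, t) = h (W (b, t)) by rewrite /w /= eqxx.
have w1 b t : w (b, I1, t) = u (b, t).
  by rewrite /w /= eqxx eq_sym (negbTE (I0_neq_I1 R)).
have wA b s t : A b -> w (b, s, t) = p (b, s, t).
  move=> Ab; rewrite /w /=; case: eqP => [->|_].
    by rewrite WA//; have [->] := p01 b t Ab.
  by case: eqP => // ->; have [_ ->] := p01 b t Ab.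
have c11 : continuous (fun x : B * I * I => x.1.1).
  by apply: continuous_comp_fun; exact: continuous_fst.
have c12 : continuous (fun x : B * I * I => x.1.2).
  by apply: (continuous_comp_fun (@continuous_snd _ _)); exact: continuous_fst.
have c2 : continuous (fun x : B * I * I => x.2) by exact: continuous_snd.
have cr : continuous (fun x : B * I * I => (x.1.1, x.2)) by exact: continuous_pair.
have [||V [cV V0 VA]] := hep_extend (closed_prism_boundary cA) hpA cG0 (q := w).
- rewrite (_ : _ `*` _ = [set x | A x.1.1] `|` ([set x | x.1.2 = I0] `|`
      [set x | x.1.2 = I1])); last first.
    apply/seteqP; split=> -[[b s] t] /=.
      by move=> [[?|?|?] _]; [left|right; left|right; right].
    by move=> [?|[?|?]]; split=> //; [constructor 1|constructor 2|constructor 3].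
  apply: (within_glue _ _ cp (_ : {within _, continuous w})) => //.
  + exact: closed_cylinder.
  + by apply: closedU; exact: closed_fiber.
  + apply: (@within_glue _ _ _ _ (h \o W \o fun x => (x.1.1, x.2))
        (u \o fun x => (x.1.1, x.2))).
    * exact: closed_fiber.
    * exact: closed_fiber.
    * apply: continuous_subspaceT; do 2!apply: continuous_comp_fun => //.
    * by apply: continuous_subspaceT; apply: continuous_comp_fun.
    * by move=> [[b s] t] /= ->.
    * by move=> [[b s] t] /= ->.
  + by move=> [[b s] t] /= Ab; rewrite wA.
- move=> [b s] [/= Ab|/= ->|/= ->].
  + by rewrite wA// G0p.
  + by rewrite w0 W0; have [] := G0E b.
  + by rewrite w1; have [] := G0E b.
exists (fun b => W (b, I1)), (fun z => V (z, I1)); split.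
- apply: (continuous_comp_fun cW); apply: continuous_pair.
    by move=> x; exact: cvg_id.
  exact: continuous_cst_fun.
- apply: (continuous_comp_fun cV); apply: continuous_pair.
    by move=> x; exact: cvg_id.
  exact: continuous_cst_fun.
- by move=> b Ab; rewrite WA.
- move=> b; rewrite !VA/=; [|by constructor 3|by constructor 2].
  by rewrite w0 w1.
- by move=> b t Ab; rewrite VA/=; [rewrite wA|constructor 1].
Qed.

(** The prescribed homotopy is absorbed into [u]: extending [p] backwards from [u] deforms [u] into
    a map equal to [h \o a] on [A]. *)
Lemma has_lifting_of_strict B (A : set B) :
  closed A -> hep R A -> hep R (prism_boundary R A) ->
  has_strict_lifting A -> has_lifting A.
Proof.
move=> cA hA hpA sA a u p ca cu cp p01.
have [|U [cU U1 UA]] := hep_extend1 cA hA cu cp.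
  by move=> b /p01[].
(* At time [t] only the part of [p] from 0 to [t] is run through: [mix s I0 t] is the product of [s]
   and [t]. The homotopy is stationary at time 0 and is [p] at time 1. *)
pose P := p \o fun x : B * I * I => (x.1.1, mix x.1.2 I0 x.2).
apply: (@lifting_solution_eq _ _ a _ (fun z => P (z, I1))) => //.
  by move=> b t Ab; rewrite /P /= mix01.
have -> : u = fun b => U (b, I1) by apply/funext => b; rewrite U1.
apply: (@lifting_solution_homotopy _ _ (a \o fst) U P) => //.
- apply: (within_comp _ _ ca); last by move=> x [].
  by apply: continuous_subspaceT; exact: continuous_fst.
- apply: (within_comp _ _ cp); last by move=> x /=.
  apply: continuous_subspaceT; apply: continuous_pair.
    by apply: continuous_comp_fun; exact: continuous_fst.
  apply: continuous_mix; last exact: continuous_snd.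
  + by apply: (continuous_comp_fun (@continuous_snd _ _)); exact: continuous_fst.
  + exact: continuous_cst_fun.
- move=> b t Ab; rewrite /P /= mix0 mix1 UA//; split=> //.
  by have [] := p01 b Ab.
apply: (@lifting_solution_eq _ _ a _ ((fun b => U (b, I0)) \o fst)) => //.
  by move=> b t Ab; rewrite /P /= mixxx UA.
apply: sA => //.
  apply: (continuous_comp_fun cU); apply: continuous_pair.
    by move=> x; exact: cvg_id.
  exact: continuous_cst_fun.
by move=> b Ab; rewrite UA//; have [] := p01 b Ab.
Qed.

(** When [A] is the sphere bounding a disk [B], [u] is a null-homotopy of [h \o a] and [a'] one of
    [a]: injectivity on homotopy groups, without base points. *)
Definition extends_if_null B (A : set B) : Prop :=
  forall a u, {within A, continuous a} -> continuous u ->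
    (forall b, A b -> u b = h (a b)) ->
  exists2 a', continuous a' & forall b, A b -> a' b = a b.

(** Surjectivity on homotopy groups, as a lifting problem with constant boundary values. *)
Definition spheroids_lift B (A : set B) : Prop :=
  forall x u, continuous u -> (forall b, A b -> u b = h x) ->
  lifting_solution A (fun _ => x) u (u \o fst).

(* An extension of the boundary values is contracted to a point, which turns
   the lifting problem into one for a spheroid. *)
Lemma strict_lifting_of_spheroids B (A : set B) (b0 : B) (c : B * I -> B) :
  closed A -> hep R A -> hep R (prism_boundary R A) -> contracts_to b0 c ->
  extends_if_null A -> spheroids_lift A -> has_strict_lifting A.
Proof.
move=> cA hA hpA [cc c0 c1] eA sA a u ca cu ua.
have [a' ca' a'a] := eA a u ca cu ua.
have chac : continuous (h \o a' \o c).
  by do 2!apply: continuous_comp_fun => //.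
(* [u] is deformed backwards in time, following the contracted extension over [A]; at time 0 it is
   constant on [A]. *)
have [||U [cU U1 UA]] := hep_extend1 cA hA cu (q := h \o a' \o c).
- exact: continuous_subspaceT.
- by move=> b Ab; rewrite /= c1 a'a ?ua.
pose P := (h \o a' \o c) \o fun x : B * I * I => (x.1.1, x.2).
apply: (@lifting_solution_eq _ _ (fun b => (a' \o c) (b, I1)) _ (fun z => P (z, I1))).
- by move=> b Ab; rewrite /= c1 a'a.
- by move=> b t Ab; rewrite /P /= c1 a'a ?ua.
have -> : u = fun b => U (b, I1) by apply/funext => b; rewrite U1.
apply: (@lifting_solution_homotopy _ _ (a' \o c) U P) => //.
- by apply: continuous_subspaceT; exact: continuous_comp_fun.
- apply: continuous_subspaceT; apply: continuous_comp_fun => //.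
  apply: continuous_pair; last exact: continuous_snd.
  by apply: continuous_comp_fun; exact: continuous_fst.
- by move=> b t Ab; rewrite /P /= UA.
apply: (@lifting_solution_eq _ _ (fun _ => a' b0) _ ((fun b => U (b, I0)) \o fst)).
- by move=> b _; rewrite /= c0.
- by move=> b t Ab; rewrite /P /= c0 UA //= c0.
apply: sA; last by move=> b Ab; rewrite UA //= c0.
apply: (continuous_comp_fun cU); apply: continuous_pair.
  by move=> x; exact: cvg_id.
exact: continuous_cst_fun.
Qed.

(** Injectivity on homotopy groups at [x]: [g] and [g'] are spheroids and [M] is a homotopy between
    their images. *)
Definition spheroid_homotopies_lift B (A : set B) : Prop :=
  forall x (g g' : B -> X) (M : B * I -> Y), continuous g -> continuous g' ->
    (forall b, A b -> g b = x /\ g' b = x) -> continuous M ->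
    (forall b, M (b, I0) = h (g b) /\ M (b, I1) = h (g' b)) ->
    (forall b t, A b -> M (b, t) = h x) ->
  exists N : B * I -> X, [/\ continuous N,
    forall b, N (b, I0) = g b /\ N (b, I1) = g' b &
    forall b t, A b -> N (b, t) = x].

(* All faces of the prism but the lid B x {1} form the range of a retraction r
   of the prism, and can be contracted to a point inside the boundary; the map
   on the lid then becomes a spheroid. *)
Lemma prism_extends_if_null B (A : set B) (b0 : B) (c : B * I -> B) :
  closed A -> hep R A -> hep R (prism_boundary R A) -> contracts_to b0 c ->
  spheroid_homotopies_lift A -> extends_if_null (prism_boundary R A).
Proof.
move=> cA hA hpA [cc c0 c1] sA a u ca cu ua.
have [r [cr rA rE]] := hA.
have cp : closed (prism_boundary R A) by exact: closed_prism_boundary.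
pose ar := a \o r.
have car : continuous ar.
  apply: (@within_comp_continuous _ _ _ (prism_boundary R A) r a) => // x.
  by case: (rA x) => ?; [constructor 1|constructor 2].
(* A contraction of the whole prism to [(b0, I0)]: [c] on the base and multiplication by the time on
   the height. *)
pose C (x : B * I * I) := (c (x.1.1, x.2), mix x.2 I0 x.1.2).
have c11 : continuous (fun x : B * I * I => x.1.1).
  by apply: continuous_comp_fun; exact: continuous_fst.
have c12 : continuous (fun x : B * I * I => x.1.2).
  by apply: (continuous_comp_fun (@continuous_snd _ _)); exact: continuous_fst.
have c2 : continuous (fun x : B * I * I => x.2) by exact: continuous_snd.
have cC : continuous C.
  apply: continuous_pair.
    by apply: continuous_comp_fun => //; exact: continuous_pair.
  by apply: continuous_mix => //; exact: continuous_cst_fun.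
have C0 x : C (x, I0) = (b0, I0) by rewrite /C /= c0 mix0.
have C1 x : C (x, I1) = x by rewrite /C /= c1 mix1; case: x.
have cid (T : topologicalType) : continuous (@id T) by move=> x; exact: cvg_id.
have cslice (T U : topologicalType) (t : U) : continuous (fun x : T => (x, t)).
  by apply: continuous_pair => //; exact: continuous_cst_fun.
have clid : continuous (fun b => a (b, I1)).
  apply: (@within_comp_continuous _ _ _ (prism_boundary R A) (fun b => (b, I1)) a).
  - exact: cslice.
  - by move=> b; constructor 3.
  - by [].
have arE b t : A b \/ t = I0 -> ar (b, t) = a (b, t) by move=> h1; rewrite /ar /= rE.
pose q (x : B * I) := ar (C (x.1, I1, x.2)).
have cq : continuous q.
  apply: (continuous_comp_fun car); apply: (continuous_comp_fun cC).
  apply: continuous_pair; last exact: continuous_snd.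
  by apply: continuous_pair; [exact: continuous_fst|exact: continuous_cst_fun].
(* The values on the lid are deformed backwards, following the contraction along the edge [A]. At
   time 0 they are constant on [A], hence form a spheroid. *)
have [||L [cL L1 LA]] := hep_extend1 cA hA clid (q := q).
- exact: continuous_subspaceT.
- by move=> b Ab; rewrite /q /= C1 arE//; left.
(* The deformation of all boundary values of the prism: [L] on the lid, the contraction on the other
   faces. *)
pose alpha (x : B * I * I) := if x.1.2 == I1 then L (x.1.1, x.2) else ar (C x).
have alphaL b t : alpha (b, I1, t) = L (b, t) by rewrite /alpha /= eqxx.
have alphaA b s t : A b -> alpha (b, s, t) = ar (C (b, s, t)).
  by move=> Ab; rewrite /alpha /=; case: eqP => // ->; rewrite LA.
have alphaB b t : alpha (b, I0, t) = ar (C (b, I0, t)).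
  by rewrite /alpha /= (negbTE (I0_neq_I1 R)).
have calpha : {within prism_boundary R A `*` setT, continuous alpha}.
  rewrite (_ : _ `*` _ = [set x : B * I * I | x.1.2 = I1] `|`
      ([set x | A x.1.1] `|` [set x | x.1.2 = I0])); last first.
    apply/seteqP; split=> -[[b s] t] /=.
      by move=> [[?|?|?] _]; [right; left|right; right|left].
    by move=> [?|[?|?]]; split=> //; [constructor 3|constructor 1|constructor 2].
  apply: (@within_glue _ _ _ _ (L \o fun x => (x.1.1, x.2)) (ar \o C)).
  - exact: closed_fiber.
  - by apply: closedU; [exact: closed_cylinder|exact: closed_fiber].
  - apply: continuous_subspaceT; apply: continuous_comp_fun => //.
    exact: continuous_pair.
  - by apply: continuous_subspaceT; exact: continuous_comp_fun.
  - by move=> [[b s] t] /= ->.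
  - by move=> [[b s] t] /= [?|->]; [rewrite alphaA|rewrite alphaB].
have alpha1 x : prism_boundary R A x -> alpha (x, I1) = a x.
  case: x => b s [/= Ab|/= ->|/= ->].
  - by rewrite alphaA// C1 arE//; left.
  - by rewrite alphaB C1 arE//; right.
  - by rewrite alphaL L1.
(* At time 0 the deformed [u] is a homotopy, constant over [A], from a constant map to the image
   under [h] of the spheroid on the lid. *)
have [||U [cU U1 UA]] := hep_extend1 cp hpA cu (q := h \o alpha).
- apply: (within_comp calpha _ (_ : {within setT, continuous h})) => //.
  exact: continuous_subspaceT.
- by move=> x px; rewrite /= alpha1// ua.
pose x0 := ar (b0, I0).
have LA0 b : A b -> L (b, I0) = x0 by move=> Ab; rewrite LA// /q C0.
have [||||||N [cN N01 NA]] := sA x0 (fun _ => x0) (fun b => L (b, I0))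
    (fun z => U (z, I0)).
- exact: continuous_cst_fun.
- by apply: continuous_comp_fun => //; exact: cslice.
- by move=> b Ab; rewrite LA0.
- by apply: continuous_comp_fun => //; exact: cslice.
- move=> b; rewrite !UA/=; [|by constructor 3|by constructor 2].
  by rewrite alphaB alphaL C0.
- by move=> b t Ab; rewrite UA/= ?alphaA// ?C0//; constructor 1.
(* The lifted homotopy [N] extends the boundary values at time 0; homotopy extension carries it
   along [alpha] to time 1, where they are [a]. *)
have [||W [cW W0 WA]] := hep_extend cp hpA cN (q := alpha) => //.
- move=> [b s] [/= Ab|/= ->|/= ->].
  + by rewrite alphaA// C0 NA.
  + by rewrite alphaB C0; have [->] := N01 b.
  + by rewrite alphaL; have [_ ->] := N01 b.
exists (fun x => W (x, I1)); first by apply: continuous_comp_fun => //; exact: cslice.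
by move=> x px; rewrite WA// alpha1.
Qed.

End Lifting.

(** * Retracts of pairs *)

Section Retracts.
Variable R : realType.
Local Notation I := (unit_interval R).

(** Only one composite is required to be the identity; this suffices to carry extension and lifting
    properties from the larger pair to the smaller one. *)
Definition retract_of (B B' : topologicalType) (A : set B) (A' : set B') : Prop :=
  exists phi psi, [/\ continuous phi, continuous psi, cancel phi psi,
    forall b, A b -> A' (phi b) & forall b, A' b -> A (psi b)].

Lemma hep_retract (B B' : topologicalType) (A : set B) (A' : set B') :
  retract_of A A' -> hep R A' -> hep R A.
Proof.
move=> [phi [psi [cphi cpsi phiK phiA psiA]]] [r [cr rA rE]].
exists (fun x => (psi (r (phi x.1, x.2)).1, (r (phi x.1, x.2)).2)).
have crp : continuous (fun x : B * I => r (phi x.1, x.2)).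
  apply: (continuous_comp_fun cr); apply: continuous_pair; last exact: continuous_snd.
  by apply: continuous_comp_fun => //; exact: continuous_fst.
split.
- apply: continuous_pair.
    apply: (continuous_comp_fun cpsi).
    by apply: continuous_comp_fun crp; exact: continuous_fst.
  by apply: continuous_comp_fun crp; exact: continuous_snd.
- by move=> x /=; case: (rA (phi x.1, x.2)); [left; exact: psiA|right].
- move=> [b t] /= bt; rewrite rE /= ?phiK//.
  by case: bt; [left; exact: phiA|right].
Qed.

Lemma has_lifting_retract (X Y : topologicalType) (h : X -> Y)
    (B B' : topologicalType) (A : set B) (A' : set B') :
  retract_of A A' -> has_lifting R h A' -> has_lifting R h A.
Proof.
move=> [phi [psi [cphi cpsi phiK phiA psiA]]] hl a u p ca cu cp p01.
have cpsi2 : continuous (fun x : B' * I => (psi x.1, x.2)).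
  apply: continuous_pair; last exact: continuous_snd.
  by apply: continuous_comp_fun => //; exact: continuous_fst.
have [||||a' [G [ca' cG a'a G01 Gp]]] :=
    hl (a \o psi) (u \o psi) (p \o fun x => (psi x.1, x.2)).
- by apply: within_comp ca => //; exact: continuous_subspaceT.
- exact: continuous_comp_fun.
- apply: within_comp cp; first exact: continuous_subspaceT.
  by move=> x [/= ? _]; split=> //; exact: psiA.
- by move=> b /psiA /p01.
exists (a' \o phi), (G \o fun x => (phi x.1, x.2)); split.
- exact: continuous_comp_fun.
- apply: continuous_comp_fun => //.
  apply: continuous_pair; last exact: continuous_snd.
  by apply: continuous_comp_fun => //; exact: continuous_fst.
- by move=> b Ab; rewrite /= a'a /= ?phiK//; exact: phiA.
- by move=> b /=; have [-> ->] := G01 (phi b); rewrite /= phiK.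
- by move=> b t Ab; rewrite /= Gp /= ?phiK//; exact: phiA.
Qed.

Lemma extends_if_null_retract (X Y : topologicalType) (h : X -> Y)
    (B B' : topologicalType) (A : set B) (A' : set B') :
  retract_of A A' -> extends_if_null h A' -> extends_if_null h A.
Proof.
move=> [phi [psi [cphi cpsi phiK phiA psiA]]] hl a u ca cu ua.
have [|||a' ca' a'a] := hl (a \o psi) (u \o psi).
- by apply: within_comp ca => //; exact: continuous_subspaceT.
- exact: continuous_comp_fun.
- by move=> b /psiA /ua.
exists (a' \o phi); first exact: continuous_comp_fun.
by move=> b Ab; rewrite /= a'a /= ?phiK//; exact: phiA.
Qed.

Lemma retract_of_trans (B1 B2 B3 : topologicalType) (A1 : set B1) (A2 : set B2)
    (A3 : set B3) :
  retract_of A1 A2 -> retract_of A2 A3 -> retract_of A1 A3.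
Proof.
move=> [f [g [cf cg fK fA gA]]] [f' [g' [cf' cg' fK' fA' gA']]].
exists (f' \o f), (g \o g'); split.
- exact: continuous_comp_fun.
- exact: continuous_comp_fun.
- by move=> b /=; rewrite fK' fK.
- by move=> b /fA /fA'.
- by move=> b /gA' /gA.
Qed.

Lemma retract_of_prism (B B' : topologicalType) (A : set B) (A' : set B') :
  retract_of A A' ->
  retract_of (prism_boundary R A) (prism_boundary R A').
Proof.
move=> [f [g [cf cg fK fA gA]]].
have cprod (T T' : topologicalType) (k : T -> T') : continuous k ->
    continuous (fun x : T * I => (k x.1, x.2)).
  move=> ck; apply: continuous_pair; last exact: continuous_snd.
  by apply: continuous_comp_fun => //; exact: continuous_fst.
exists (fun x => (f x.1, x.2)), (fun x => (g x.1, x.2)).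
split; [exact: cprod|exact: cprod| | |].
- by move=> [b t] /=; rewrite fK.
- by move=> [b t] [/= /fA ?|/= ?|/= ?]; [constructor 1|constructor 2|constructor 3].
- by move=> [b t] [/= /gA ?|/= ?|/= ?]; [constructor 1|constructor 2|constructor 3].
Qed.

End Retracts.

(** * Cubes and disks *)

Section RowVectors.
Variable R : realType.

Lemma continuous_row (T : topologicalType) n (f : T -> 'rV[R]_n) :
  (forall i, continuous (fun t => f t ord0 i)) -> continuous f.
Proof.
move=> cf t A [P nP PA].
have : \forall s \near t, forall i, P ord0 i (f s ord0 i).
  by apply: filter_forall => i; apply: cf; exact: nP.
by apply: filterS => s Ps; apply: PA => i j; rewrite ord1; exact: Ps.
Qed.

Lemma continuous_coord n (i : 'I_n) : continuous (fun v : 'rV[R]_n => v ord0 i).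
Proof. exact: coord_continuous. Qed.

Lemma sup_norm_coord n (v : 'rV[R]_n) i : `|v ord0 i| <= `|v|.
Proof.
rewrite [leRHS]mx_normrE; apply/bigmax_geP; right => /=.
by exists (ord0, i).
Qed.

Lemma sup_norm_attained n (v : 'rV[R]_n) :
  `|v| != 0 -> exists i, `|v| = `|v ord0 i|.
Proof. by move=> /mx_norm_neq0[[j i] vE]; exists i; rewrite [LHS]vE ord1. Qed.

Lemma sup_norm_le1 n (v : 'rV[R]_n) :
  (forall i, `|v ord0 i| <= 1) -> `|v| <= 1.
Proof.
move=> v1; have [->//|/sup_norm_attained[i ->]//] := eqVneq `|v| 0.
Qed.

Definition l2norm n (v : 'rV[R]_n) : R := Num.sqrt (sqnorm v).

Lemma sqnorm_ge0 n (v : 'rV[R]_n) : 0 <= sqnorm v.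
Proof. by apply: sumr_ge0 => i _; exact: sqr_ge0. Qed.

Lemma continuous_sqnorm n : continuous (@sqnorm R n).
Proof.
apply: continuous_big => [|i _]; first exact: add_continuous.
apply: (@continuous_comp_fun _ _ _ (fun x : R => x ^+ 2)).
  exact: exprn_continuous.
exact: continuous_coord.
Qed.

Lemma continuous_l2norm n : continuous (@l2norm n).
Proof.
apply: (@continuous_comp_fun _ _ _ Num.sqrt); first exact: sqrt_continuous.
exact: continuous_sqnorm.
Qed.

Lemma l2norm_ge0 n (v : 'rV[R]_n) : 0 <= l2norm v.
Proof. exact: sqrtr_ge0. Qed.

Lemma l2norm_coord n (v : 'rV[R]_n) i : `|v ord0 i| <= l2norm v.
Proof.
rewrite -sqrtr_sqr ler_wsqrtr// /sqnorm (bigD1 i)//= lerDl.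
by apply: sumr_ge0 => j _; exact: sqr_ge0.
Qed.

Lemma l2normZ n (c : R) (v : 'rV[R]_n) : 0 <= c -> l2norm (c *: v) = c * l2norm v.
Proof.
move=> c0; rewrite /l2norm /sqnorm; under eq_bigr do rewrite mxE exprMn.
by rewrite -mulr_sumr sqrtrM ?sqr_ge0// sqrtr_sqr ger0_norm.
Qed.

Lemma l2norm_le1 n (v : 'rV[R]_n) : (l2norm v <= 1) = (sqnorm v <= 1).
Proof. by rewrite -[X in _ <= X]sqrtr1 ler_sqrt// ltr01. Qed.

Lemma l2norm_eq1 n (v : 'rV[R]_n) : (l2norm v = 1) <-> (sqnorm v = 1).
Proof.
split=> [v1|v1]; last by rewrite /l2norm v1 sqrtr1.
by rewrite -[LHS](sqr_sqrtr (sqnorm_ge0 v)) -/(l2norm v) v1 expr1n.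
Qed.

End RowVectors.

(** * Radial rescaling from one norm to another *)

Section RadialRescaling.
Variables (R : realType) (n : nat) (N M : 'rV[R]_n -> R).
Hypotheses (cN : continuous N) (cM : continuous M).
Hypotheses (NZ : forall (c : R) (v : 'rV[R]_n), 0 <= c -> N (c *: v) = c * N v)
  (MZ : forall (c : R) (v : 'rV[R]_n), 0 <= c -> M (c *: v) = c * M v).
Hypotheses (N_coord : forall (v : 'rV[R]_n) i, `|v ord0 i| <= N v)
  (M_coord : forall (v : 'rV[R]_n) i, `|v ord0 i| <= M v).
Hypotheses (N_ge0 : forall v, 0 <= N v) (M_ge0 : forall v, 0 <= M v).

Let N0 : N 0 = 0. Proof. by rewrite -(scale0r 0) NZ// mul0r. Qed.
Let M0 : M 0 = 0. Proof. by rewrite -(scale0r 0) MZ// mul0r. Qed.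
Let Meq0 v : M v = 0 -> v = 0.
Proof.
move=> v0; apply/rowP => i; rewrite mxE; apply/eqP; rewrite -normr_le0 -v0.
exact: M_coord.
Qed.

(** Each vector moves along its ray until its [M]-norm equals its former [N]-norm. At 0 the quotient
    is a default value, multiplied by the zero vector. *)
Definition rescale (v : 'rV[R]_n) : 'rV[R]_n := (N v / M v) *: v.

Lemma rescale_norm v : M (rescale v) = N v.
Proof.
have [/Meq0 ->|Mv] := eqVneq (M v) 0; first by rewrite /rescale scaler0 M0 N0.
by rewrite MZ ?divr_ge0// divfK.
Qed.

(** Away from 0 this is a quotient of continuous functions. At 0, each coordinate of the result is
    bounded by [N], because [M] dominates coordinates, and [N] tends to 0. *)
Lemma continuous_rescale : continuous rescale.
Proof.
apply: continuous_row => i v.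
have [/Meq0 v0|Mv] := eqVneq (M v) 0.
  rewrite /continuous_at /rescale v0 scaler0 mxE.
  have cN0 : N w @[w --> (0 : 'rV[R]_n)] --> (0 : R).
    by rewrite -[X in _ --> X]N0; exact: cN.
  apply: (@squeeze_cvgr _ (nbhs (0 : 'rV[R]_n)) _ R (fun w => - N w) N).
  - apply: nearW => w; rewrite -ler_norml mxE normrM normrM normfV.
    rewrite (ger0_norm (N_ge0 w)) (ger0_norm (M_ge0 w)).
    have [/Meq0 ->|Mw] := eqVneq (M w) 0; first by rewrite mxE normr0 mulr0 N_ge0.
    have Mw0 : 0 < M w by rewrite lt_neqAle eq_sym Mw M_ge0.
    by rewrite -mulrA ler_piMr// mulrC ler_pdivrMr// mul1r.
  - by rewrite -[X in _ --> X]oppr0; apply: cvgN; exact: cN0.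
  - exact: cN0.
rewrite (_ : (fun w => rescale w ord0 i) = fun w => N w * (M w)^-1 * w ord0 i).
  exact: (cvgM (cvgM (@cN v) (cvgV Mv (@cM v))) (@continuous_coord R n i v)).
by apply/funext => w; rewrite mxE.
Qed.

End RadialRescaling.

Lemma rescaleK (R : realType) n (N M : 'rV[R]_n -> R) :
  (forall (c : R) (v : 'rV[R]_n), 0 <= c -> N (c *: v) = c * N v) ->
  (forall (c : R) (v : 'rV[R]_n), 0 <= c -> M (c *: v) = c * M v) ->
  (forall (v : 'rV[R]_n) i, `|v ord0 i| <= N v) ->
  (forall (v : 'rV[R]_n) i, `|v ord0 i| <= M v) ->
  (forall v, 0 <= N v) -> (forall v, 0 <= M v) ->
  cancel (rescale N M) (rescale M N).
Proof.
move=> NZ MZ N_coord M_coord N_ge0 M_ge0 v.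
rewrite {1}/rescale rescale_norm// {1 2}/rescale NZ ?divr_ge0// scalerA.
have eq0 (K : 'rV[R]_n -> R) :
    (forall (v : 'rV[R]_n) i, `|v ord0 i| <= K v) -> K v = 0 -> v = 0.
  move=> K_coord v0; apply/rowP => i; rewrite mxE; apply/eqP.
  by rewrite -normr_le0 -v0; exact: K_coord.
have [/(eq0 _ N_coord) ->|Nv] := eqVneq (N v) 0; first by rewrite scaler0.
have [/(eq0 _ M_coord) ->|Mv] := eqVneq (M v) 0; first by rewrite scaler0.
rewrite (_ : _ * _ = 1) ?scale1r//; field.
by rewrite Nv Mv.
Qed.

(** * Cubes, prisms over cubes, and disks *)

Section Cubes.
Variable R : realType.
Local Notation I := (unit_interval R).

(** Affine coordinates in which the cube is the unit ball of the sup norm and its boundary the unit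
    sphere. *)
Definition center n (v : cube R n) : 'rV[R]_n := 2%:R *: set_val v - const_mx 1.

Lemma cube_coord n (v : cube R n) i : 0 <= (set_val v : 'rV[R]_n) ord0 i <= 1.
Proof. exact: (set_valP v). Qed.

Lemma uncenter_subproof n (w : 'rV[R]_n) :
  cube R n (\row_i set_val (clamp ((1 + w ord0 i) / 2))).
Proof. by move=> i; rewrite mxE; exact: unit_interval_bounds. Qed.

(** Clamping the coordinates makes this inverse of [center] total. *)
Definition uncenter n (w : 'rV[R]_n) : cube R n :=
  exist _ (\row_i set_val (clamp ((1 + w ord0 i) / 2)))
    (mem_set (uncenter_subproof w)).

Lemma uncenterE n (w : 'rV[R]_n) i :
  (set_val (uncenter w) : 'rV[R]_n) ord0 i = set_val (clamp ((1 + w ord0 i) / 2)).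
Proof.
transitivity ((\row_i set_val (clamp ((1 + w ord0 i) / 2)) : 'rV[R]_n) ord0 i) => //.
by rewrite mxE.
Qed.

Lemma cube_inj n (v w : cube R n) :
  (forall i, (set_val v : 'rV[R]_n) ord0 i = (set_val w : 'rV[R]_n) ord0 i) -> v = w.
Proof. by move=> vw; apply: val_inj; apply/rowP => i; exact: vw. Qed.

Lemma continuous_cube_coord n (i : 'I_n) :
  continuous (fun v : cube R n => (set_val v : 'rV[R]_n) ord0 i).
Proof.
apply: (@continuous_comp_fun _ _ _ (fun v : 'rV[R]_n => v ord0 i)).
  exact: continuous_coord.
exact: continuous_set_val.
Qed.

Lemma center_coord n (v : cube R n) i :
  center v ord0 i = 2 * (set_val v : 'rV[R]_n) ord0 i - 1.
Proof. by rewrite !mxE. Qed.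

Lemma continuous_center n : continuous (@center n).
Proof.
apply: continuous_row => i.
rewrite (_ : (fun v => center v ord0 i) =
  fun v : cube R n => 2 * (set_val v : 'rV[R]_n) ord0 i - 1).
  move=> v.
  exact: (cvgB (cvgM (cvg_cst _) (@continuous_cube_coord n i v)) (cvg_cst _)).
by apply/funext => v; rewrite center_coord.
Qed.

Lemma continuous_uncenter n : continuous (@uncenter n).
Proof.
apply: continuous_to_set_type; apply: continuous_row => i.
rewrite (_ : (fun w => _) =
    set_val \o (@clamp R \o fun w : 'rV[R]_n => (1 + w ord0 i) / 2)); last first.
  by apply/funext => w; rewrite uncenterE.
apply: continuous_comp_fun; first exact: continuous_set_val.
apply: continuous_comp_fun; first exact: continuous_clamp.
move=> v.
exact: (cvgM (cvgD (cvg_cst _) (@continuous_coord R n i v)) (cvg_cst _)).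
Qed.

Lemma center_le1 n (v : cube R n) : `|center v| <= 1.
Proof.
apply: sup_norm_le1 => i; rewrite center_coord ler_norml.
by have /andP[? ?] := cube_coord v i; apply/andP; split; lra.
Qed.

Lemma centerK n : cancel (@center n) (@uncenter n).
Proof.
move=> v; apply: cube_inj => i; rewrite uncenterE center_coord.
rewrite (_ : _ / 2 = (set_val v : 'rV[R]_n) ord0 i); last by field.
by rewrite clampE//; exact: cube_coord.
Qed.

Lemma uncenterK n (w : 'rV[R]_n) : `|w| <= 1 -> center (uncenter w) = w.
Proof.
move=> w1; apply/rowP => i; rewrite center_coord uncenterE clampE; first by field.
have := le_trans (sup_norm_coord w i) w1; rewrite ler_norml => /andP[? ?].
by apply/andP; split; lra.
Qed.

Lemma cube_boundaryP n (v : cube R n) : cube_boundary v <-> `|center v| = 1.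
Proof.
split=> [[i vi]|v1].
  apply/eqP; rewrite eq_le center_le1 (le_trans _ (sup_norm_coord (center v) i))//.
  rewrite center_coord; case: vi => ->; rewrite ?mulr0 ?mulr1 ?sub0r ?normrN ?normr1//.
  by rewrite (_ : 2 - 1 = 1 :> R) ?normr1//; lra.
have [i] : exists i, `|center v| = `|center v ord0 i|.
  by apply: sup_norm_attained; rewrite v1 oner_eq0.
rewrite v1 center_coord => vi; exists i.
have [h0|h0] := leP 0 (2 * (set_val v : 'rV[R]_n) ord0 i - 1).
  by right; move: vi; rewrite ger0_norm//; lra.
by left; move: vi; rewrite ltr0_norm//; lra.
Qed.

Lemma continuous_center_norm n : continuous (fun v : cube R n => `|center v|).
Proof.
by move=> v; exact: (cvg_norm (@continuous_center n v)).
Qed.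

Lemma closed_cube_boundary n : closed (@cube_boundary R n).
Proof.
rewrite (_ : @cube_boundary R n = (fun v : cube R n => `|center v|) @^-1` [set 1]).
  have /continuous_closedP c := @continuous_center_norm n.
  exact: (c _ (@closed_eq _ _)).
by apply/seteqP; split => v /cube_boundaryP.
Qed.

Lemma compact_cube n : compact [set: cube R n].
Proof.
apply: compact_set_type.
have := @rV_compact R n (fun _ => `[0, 1]%classic) (fun _ => @segment_compact R 0 1).
congr compact; apply/seteqP; split => v /= vi i; move: (vi i); by rewrite in_itv.
Qed.

(* Radial projection of the prism [-1,1]^n x [0,1] from the point (0, 2). *)
Lemma hep_cube n : hep R (@cube_boundary R n).
Proof.
(* The segment from [(0, 2)] to [(v, t)], prolonged by the factor [1 / m], ends at
   [(v / m, 2 - (2 - t) / m)]. It meets a wall when [m] is the norm of [v] and the bottom when [m]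
   is [(2 - t) / 2]; the larger value is met first. *)
pose m (x : cube R n * I) := Num.max `|center x.1| (1 - set_val x.2 / 2).
have m_gt0 x : 0 < m x.
  rewrite lt_max; apply/orP; right.
  by have /andP[_ ?] := unit_interval_bounds x.2; lra.
have c1 : continuous (fun x : cube R n * I => center x.1).
  by apply: (continuous_comp_fun (@continuous_center n)); exact: continuous_fst.
have c2 : continuous (fun x : cube R n * I => set_val x.2).
  apply: (@continuous_comp_fun _ _ _ set_val); first exact: continuous_set_val.
  exact: continuous_snd.
have cm : continuous m.
  have cf : continuous (fun x : cube R n * I => `|center x.1| : R^o).
    by move=> x; exact: (cvg_norm (c1 x)).
  have cg : continuous (fun x : cube R n * I => 1 - set_val x.2 / 2 : R^o).
    by move=> x; exact: (cvgB (cvg_cst _) (cvgM (c2 x) (cvg_cst _))).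
  by move=> x; exact: (continuous_max (cf x) (cg x)).
have cmV : continuous (fun x => (m x)^-1).
  by move=> x; apply: cvgV; [rewrite gt_eqF|exact: cm].
pose s x := 2 - (2 - set_val x.2) / m x.
have m_le1 x : m x <= 1.
  rewrite ge_max center_le1 /=.
  by have /andP[? _] := unit_interval_bounds x.2; lra.
have s01 x : 0 <= s x <= 1.
  have /andP[t0 t1] := unit_interval_bounds x.2.
  have mt : 1 - set_val x.2 / 2 <= m x by rewrite /m le_max lexx orbT.
  rewrite /s; apply/andP; split.
    by rewrite subr_ge0 ler_pdivrMr//; lra.
  rewrite lerBlDr -lerBlDl ler_pdivlMr//; have := m_le1 x; lra.
have v1 x : `|(m x)^-1 *: center x.1| <= 1.
  rewrite normrZ ger0_norm ?invr_ge0 ?(ltW (m_gt0 x))// mulrC ler_pdivrMr// mul1r.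
  by rewrite /m le_max lexx.
exists (fun x => (uncenter ((m x)^-1 *: center x.1), clamp (s x))); split.
- apply: continuous_pair.
    apply: (continuous_comp_fun (@continuous_uncenter n)) => x.
    by apply: cvgZ; [exact: cmV|exact: c1].
  apply: (continuous_comp_fun (@continuous_clamp R)) => x.
  apply: cvgB; first exact: cvg_cst.
  by apply: cvgM; [apply: cvgB; [exact: cvg_cst|exact: c2]|exact: cmV].
(* The term that attains the maximum decides between the bottom and the walls. *)
- move=> x /=; have [mE|mE] := leP `|center x.1| (1 - set_val x.2 / 2).
    right; apply: unit_interval_inj; rewrite clampE// I0E /s /m max_r//.
    field; rewrite -[X in X != 0](_ : 2 * m x = _) ?mulf_neq0 ?gt_eqF//.
    by rewrite /m max_r//; field.
  left; apply/cube_boundaryP; rewrite uncenterK//.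
  rewrite normrZ ger0_norm ?invr_ge0 ?(ltW (m_gt0 x))// {1}/m max_l ?(ltW mE)// mulVf//.
  by rewrite gt_eqF// (le_lt_trans _ mE)//; have /andP[_ ?] := unit_interval_bounds x.2; lra.
- move=> x bx; have mx1 : m x = 1.
    apply/eqP; rewrite eq_le m_le1 /= le_max; case: bx => [/cube_boundaryP ->|->].
      by rewrite lexx.
    by rewrite I0E mul0r subr0 lexx orbT.
  rewrite mx1 invr1 scale1r centerK [RHS]surjective_pairing; congr pair.
  apply: unit_interval_inj; rewrite clampE// /s mx1 divr1; lra.
Qed.

Lemma cube_contraction n :
  exists (b0 : cube R n) (c : cube R n * I -> cube R n),
    contracts_to b0 c.
Proof.
have cube0 : cube R n 0 by move=> i; rewrite mxE lexx ler01.
have cubeZ (x : cube R n * I) : cube R n (set_val x.2 *: (set_val x.1 : 'rV[R]_n)).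
  move=> i; rewrite mxE.
  have /andP[? ?] := unit_interval_bounds x.2; have /andP[? ?] := cube_coord x.1 i.
  by apply/andP; split; nra.
exists (exist _ (0 : 'rV[R]_n) (mem_set cube0)), (fun x =>
  exist _ (set_val x.2 *: (set_val x.1 : 'rV[R]_n)) (mem_set (cubeZ x))).
split.
- apply: continuous_to_set_type => x; apply: cvgZ.
    apply: (@continuous_comp_fun _ _ _ set_val); first exact: continuous_set_val.
    exact: continuous_snd.
  apply: (@continuous_comp_fun _ _ _ set_val); first exact: continuous_set_val.
  exact: continuous_fst.
- by move=> b; apply: val_inj; rewrite /= scale0r.
- by move=> b; apply: val_inj; rewrite /= scale1r.
Qed.

Definition cube_cons n (x : cube R n * I) : 'rV[R]_n.+1 :=
  \row_i if unlift ord0 i is Some j then (set_val x.1 : 'rV[R]_n) ord0 j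
         else set_val x.2.

Lemma cube_cons0 n (x : cube R n * I) : cube_cons x ord0 ord0 = set_val x.2.
Proof. by rewrite mxE unlift_none. Qed.

Lemma cube_consS n (x : cube R n * I) j :
  cube_cons x ord0 (lift ord0 j) = (set_val x.1 : 'rV[R]_n) ord0 j.
Proof. by rewrite mxE liftK. Qed.

(** The prism is a cube with the height as coordinate 0. Both directions serve: homotopy extension
    and lifting pass from cubes to prisms, extension of boundary values from prisms to cubes. *)
Lemma prism_cube_retract n :
  retract_of (prism_boundary R (@cube_boundary R n)) (@cube_boundary R n.+1) /\
  retract_of (@cube_boundary R n.+1) (prism_boundary R (@cube_boundary R n)).
Proof.
have consP x : cube R n.+1 (@cube_cons n x).
  move=> i; case: (unliftP ord0 i) => [j ->|->].
    by rewrite cube_consS; exact: cube_coord.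
  by rewrite cube_cons0; exact: unit_interval_bounds.
have tlP (w : cube R n.+1) : cube R n (\row_j (set_val w : 'rV[R]_n.+1) ord0 (lift ord0 j)).
  by move=> i; rewrite mxE; exact: cube_coord.
pose phi x : cube R n.+1 := exist _ (@cube_cons n x) (mem_set (consP x)).
pose tl (w : cube R n.+1) : cube R n := exist _
  (\row_j (set_val w : 'rV[R]_n.+1) ord0 (lift ord0 j)) (mem_set (tlP w)).
pose hd (w : cube R n.+1) := clamp ((set_val w : 'rV[R]_n.+1) ord0 ord0).
have tlE w j : (set_val (tl w) : 'rV[R]_n) ord0 j =
    (set_val w : 'rV[R]_n.+1) ord0 (lift ord0 j).
  transitivity ((\row_j (set_val w : 'rV[R]_n.+1) ord0 (lift ord0 j)) ord0 j) => //.
  by rewrite mxE.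
have hdE w : set_val (hd w) = (set_val w : 'rV[R]_n.+1) ord0 ord0.
  by rewrite clampE//; exact: cube_coord.
have phiE x : (set_val (phi x) : 'rV[R]_n.+1) = cube_cons x by [].
pose psi w := (tl w, hd w).
have cphi : continuous phi.
  apply: continuous_to_set_type; apply: continuous_row => i.
  case: (unliftP ord0 i) => [j ->|->].
    rewrite (_ : (fun _ => _) = (fun x : cube R n * I => (set_val x.1 : 'rV[R]_n) ord0 j)).
      apply: (@continuous_comp_fun _ _ _
        (fun v : cube R n => (set_val v : 'rV[R]_n) ord0 j)).
        exact: continuous_cube_coord.
      exact: continuous_fst.
    by apply/funext => x; rewrite phiE cube_consS.
  rewrite (_ : (fun _ => _) = (fun x : cube R n * I => set_val x.2)).
    apply: (@continuous_comp_fun _ _ _ set_val); first exact: continuous_set_val.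
    exact: continuous_snd.
  by apply/funext => x; rewrite phiE cube_cons0.
have cpsi : continuous psi.
  apply: continuous_pair.
    apply: continuous_to_set_type; apply: continuous_row => i.
    rewrite (_ : (fun _ => _) = (fun w : cube R n.+1 =>
      (set_val w : 'rV[R]_n.+1) ord0 (lift ord0 i))); first exact: continuous_cube_coord.
    by apply/funext => w; rewrite tlE.
  apply: (continuous_comp_fun (@continuous_clamp R)); exact: continuous_cube_coord.
have phiK : cancel phi psi.
  move=> [v t]; congr pair.
    by apply: cube_inj => i; rewrite tlE phiE cube_consS.
  by apply: unit_interval_inj; rewrite hdE phiE cube_cons0.
have phiA x : prism_boundary R (@cube_boundary R n) x -> cube_boundary (phi x).
  move=> [[i vi]|xt|xt].
  + by exists (lift ord0 i); rewrite phiE cube_consS.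
  + by exists ord0; rewrite phiE cube_cons0 xt; left.
  + by exists ord0; rewrite phiE cube_cons0 xt; right.
have psiA w : cube_boundary w -> prism_boundary R (@cube_boundary R n) (psi w).
  move=> [i]; case: (unliftP ord0 i) => [j ->|->] wi.
    by constructor 1; exists j; rewrite /= tlE.
  case: wi => wi; [constructor 2|constructor 3]; apply: unit_interval_inj;
    by rewrite /= hdE wi.
have psiK : cancel psi phi.
  move=> w; apply: cube_inj => i; rewrite phiE; case: (unliftP ord0 i) => [j ->|->].
    by rewrite cube_consS tlE.
  by rewrite cube_cons0 hdE.
by split; [exists phi, psi|exists psi, phi]; split.
Qed.

(** Rescaling from the Euclidean norm to the sup norm carries the disk to the centered cube, sphere
    to boundary. *)
Lemma disk_cube_retract n :
  retract_of (@disk_boundary R n) (@cube_boundary R n).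
Proof.
pose N := @l2norm R n; pose M (v : 'rV[R]_n) : R := `|v|.
have NZ (c : R) v : 0 <= c -> N (c *: v) = c * N v by exact: l2normZ.
have MZ (c : R) v : 0 <= c -> M (c *: v) = c * M v.
  by move=> c0; rewrite /M normrZ ger0_norm.
have Nc (v : 'rV[R]_n) i : `|v ord0 i| <= N v by exact: l2norm_coord.
have Mc (v : 'rV[R]_n) i : `|v ord0 i| <= M v by exact: sup_norm_coord.
have N0 v : 0 <= N v by exact: l2norm_ge0.
have M0 v : 0 <= M v by exact: normr_ge0.
have cN : continuous N by exact: continuous_l2norm.
have cM : continuous M by exact: norm_continuous.
have psiP (w : cube R n) : disk R n (rescale M N (center w)).
  by rewrite /disk /= -l2norm_le1 -/(N _) rescale_norm//; exact: center_le1.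
have phi1 (v : disk R n) : `|rescale N M (set_val v)| <= 1.
  by rewrite -/(M _) rescale_norm// l2norm_le1; exact: (set_valP v).
exists (fun v : disk R n => uncenter (rescale N M (set_val v))),
  (fun w => exist _ (rescale M N (center w)) (mem_set (psiP w))); split.
- apply: (continuous_comp_fun (@continuous_uncenter n)).
  apply: (@continuous_comp_fun _ _ _ (rescale N M)); first exact: continuous_rescale.
  exact: continuous_set_val.
- apply: continuous_to_set_type.
  apply: (@continuous_comp_fun _ _ _ (rescale M N)); first exact: continuous_rescale.
  exact: continuous_center.
- by move=> v; apply: val_inj; rewrite /= uncenterK// rescaleK.
- move=> v v1; apply/cube_boundaryP; rewrite uncenterK// -/(M _) rescale_norm//.
  exact/l2norm_eq1.
- move=> w /cube_boundaryP w1; rewrite /disk_boundary /=; apply/l2norm_eq1.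
  by rewrite (_ : l2norm _ = N (rescale M N (center w)))// rescale_norm.
Qed.

Lemma closed_disk_boundary n : closed (@disk_boundary R n).
Proof.
have : continuous (fun v : disk R n => sqnorm (set_val v : 'rV[R]_n)).
  apply: (continuous_comp_fun (@continuous_sqnorm R n)); exact: continuous_set_val.
by move=> /continuous_closedP c; exact: (c _ (@closed_eq _ 1)).
Qed.

Lemma compact_disk n : compact [set: disk R n].
Proof.
apply: compact_set_type; apply: bounded_closed_compact.
  exists 1; split=> // x x1 v; rewrite /disk /= -l2norm_le1 => v1.
  apply: ltW; apply: le_lt_trans x1; apply: sup_norm_le1 => i.
  exact: le_trans (l2norm_coord v i) v1.
have /continuous_closedP c := @continuous_sqnorm R n.
exact: (c [set x | x <= 1] (@closed_le _ 1)).
Qed.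

End Cubes.

(** * Lifting through a weak homotopy equivalence *)

Section WeakEquivalenceLifting.
Variables (R : realType) (X Y : topologicalType) (h : X -> Y).
Hypothesis wh : weak_homotopy_equivalence R h.
Local Notation I := (unit_interval R).

Let ch : continuous h. Proof. by case: wh. Qed.

Lemma cube0_unique (v w : cube R 0) : v = w.
Proof. by apply: cube_inj => -[]. Qed.

Lemma cube0_inhabited : inhabited (cube R 0).
Proof. by have [v _] := cube_contraction R 0; exists. Qed.

Lemma spheroids_lift_cube n : spheroids_lift R h (@cube_boundary R n.+1).
Proof.
move=> x u cu ux; have [_ _ /(_ n.+1 x isT)[_ surj]] := wh.
have [|g [cg gx] [H [cH H0 H1 Hb]]] := surj u; first by [].
exists g, H; split; [exact: cg|exact: cH|exact: gx| |].
  by move=> b; rewrite H0 H1.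
by move=> b t Ab; rewrite Hb //= ux.
Qed.

(** In dimension 0 the cube is a point with empty boundary, and injectivity on path components
    replaces injectivity on a homotopy group. *)
Lemma spheroid_homotopies_lift_cube n :
  spheroid_homotopies_lift R h (@cube_boundary R n).
Proof.
move=> x g g' M cg cg' ggx cM M01 Mx; case: n g g' M cg cg' ggx cM M01 Mx.
  move=> g g' M cg cg' _ cM M01 _; have [v] := cube0_inhabited.
  have [_ [inj _] _] := wh.
  have [|p [cp p0 p1]] := inj (g v) (g' v).
    exists (fun t => M (v, t)); have [? ?] := M01 v; split=> //.
    exact: continuous_slice.
  exists (fun z => p z.2); split.
  - by apply: (continuous_comp_fun cp); exact: continuous_snd.
  - by move=> b /=; rewrite p0 p1 (cube0_unique b v).
  - by move=> b t [[]].
move=> n g g' M cg cg' ggx cM M01 Mx.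
have [_ _ /(_ n.+1 x isT)[inj _]] := wh.
have [||| N [cN N0 N1 Nb]] := inj g g'.
- by split=> // v /ggx[].
- by split=> // v /ggx[].
- by exists M; split=> // v; have [] := M01 v.
by exists N; split=> // b t; exact: Nb.
Qed.

(** Dimension 0 is surjectivity on path components. For the cube of dimension [n.+1], seen as a
    prism, injectivity in degree [n] extends the boundary values and surjectivity in degree [n.+1]
    lifts the remaining spheroid. *)
Lemma has_lifting_cube n : has_lifting R h (@cube_boundary R n).
Proof.
case: n => [|n].
  move=> a u p _ cu _ _; have [v] := cube0_inhabited.
  have [_ [_ surj] _] := wh.
  have [x [q [cq q0 q1]]] := surj (u v).
  exists (fun _ => x), (fun z => q z.2); split.
  - exact: continuous_cst_fun.
  - by apply: (continuous_comp_fun cq); exact: continuous_snd.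
  - by move=> b [[]].
  - by move=> b; rewrite /= q0 q1 (cube0_unique b v).
  - by move=> b t [[]].
have hepP m : hep R (prism_boundary R (@cube_boundary R m)).
  by have [r _] := prism_cube_retract R m; apply: hep_retract r _; exact: hep_cube.
have cb m : closed (@cube_boundary R m) by exact: closed_cube_boundary.
have hc m : hep R (@cube_boundary R m) by exact: hep_cube.
have [b0 [c cc]] := cube_contraction R n.+1.
apply: has_lifting_of_strict => //.
apply: (strict_lifting_of_spheroids ch _ _ _ cc) => //.
- have [_ r] := prism_cube_retract R n; apply: extends_if_null_retract r _.
  have [b1 [c1 cc1]] := cube_contraction R n.
  apply: (prism_extends_if_null ch _ _ _ cc1) => //.
  exact: spheroid_homotopies_lift_cube.
- exact: spheroids_lift_cube.
Qed.

Lemma has_lifting_disk n : has_lifting R h (@disk_boundary R n).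
Proof.
apply: has_lifting_retract (disk_cube_retract R n) _; exact: has_lifting_cube.
Qed.

(** The prism over a disk is a retract of the prism over a cube, hence of a cube one dimension
    up. *)
Lemma has_lifting_disk_prism n :
  has_lifting R h (prism_boundary R (@disk_boundary R n)).
Proof.
apply: has_lifting_retract (@has_lifting_cube n.+1).
have [r _] := prism_cube_retract R n; apply: retract_of_trans r.
exact: retract_of_prism (disk_cube_retract R n).
Qed.

End WeakEquivalenceLifting.

(** * Sections over CW-complexes *)

Section CWSections.
Variables (R : realType) (W E : topologicalType) (C : W -> set E).
Hypothesis hW : hausdorff_space W.
Variables (J : Type) (d : J -> nat) (Phi : forall j, disk R (d j) -> W).
Hypothesis cw : is_cw_structure Phi.

Let cPhi j : continuous (@Phi j). Proof. by case: cw. Qed.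

Lemma open_cell_unique i j w : open_cell Phi i w -> open_cell Phi j w -> i = j.
Proof.
move=> iw jw; have [_ _ [_ triv _] _ _] := cw.
by apply: triv => //; exists w.
Qed.

Lemma open_cell_exists w : exists j, open_cell Phi j w.
Proof.
have [_ _ [cov _ _] _ _] := cw.
have : [set: W] w by [].
by rewrite -cov => -[j _ jw]; exists j.
Qed.

Definition cell_of w : J := projT1 (cid (open_cell_exists w)).

Lemma cell_ofP w : open_cell Phi (cell_of w) w.
Proof. by rewrite /cell_of; case: cid. Qed.

Lemma cell_of_interior j v : disk_interior R (d j) v -> cell_of (Phi v) = j.
Proof.
by move=> vi; apply: (open_cell_unique (cell_ofP _)); exists v.
Qed.

Lemma disk_dichotomy n (v : disk R n) :
  disk_interior R n v \/ disk_boundary R n v.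
Proof.
have : sqnorm (set_val v : 'rV[R]_n) <= 1 by exact: (set_valP v).
by rewrite le_eqVlt => /orP[/eqP|]; [right|left].
Qed.

Lemma boundary_dim j v : disk_boundary R (d j) v -> (d (cell_of (Phi v)) < d j)%N.
Proof.
move=> vb; have [_ _ _ /(_ j)[F [_ Fd bF]] _] := cw.
have [|i Fi iv] := bF (Phi v); first by exists v.
by rewrite (open_cell_unique (cell_ofP _) iv); exact: Fd.
Qed.

Lemma closed_cell_dim j v : (d (cell_of (@Phi j v)) <= d j)%N.
Proof.
have [/cell_of_interior ->//|/boundary_dim/ltnW//] := disk_dichotomy v.
Qed.

(* A closed cell is a quotient of a compact disk, and W is Hausdorff: images of
   closed subsets of disks are closed. *)
Lemma within_closed_cells (F : set J) (e : W -> E) :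
  finite_set F -> (forall i, F i -> continuous (e \o @Phi i)) ->
  {within \bigcup_(i in F) range (@Phi i), continuous e}.
Proof.
move=> finF ce; apply/continuous_closedP => A cA; apply/closed_subspaceP.
exists (\bigcup_(i in F) (@Phi i @` ((e \o @Phi i) @^-1` A))).
  apply: (@closed_bigcup _ {classic J}) => // i Fi; apply: compact_closed => //.
  apply: continuous_compact.
    by apply: continuous_subspaceT; exact: cPhi.
  apply: (subclosed_compact _ (@compact_disk R (d i))) => //.
  by have /continuous_closedP c := ce i Fi; exact: c.
apply/seteqP; split=> w [].
  by move=> [i Fi [v /= Av <-]] K; split=> //.
by move=> Aw [i Fi [v _ vw]]; split; exists i => //; exists v => //=; rewrite vw.
Qed.

(** By closure finiteness the boundary sphere is mapped into finitely many closed cells of smaller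
    dimension, on whose union [e] is continuous. *)
Lemma boundary_within j (e : W -> E) :
  (forall i, (d i < d j)%N -> continuous (e \o @Phi i)) ->
  {within disk_boundary R (d j), continuous (e \o @Phi j)}.
Proof.
move=> ce; have [_ _ _ /(_ j)[F [finF Fd bF]] _] := cw.
apply: (@within_comp _ _ _ _ (\bigcup_(i in F) range (@Phi i))).
- by apply: continuous_subspaceT; exact: cPhi.
- move=> v vb; have [|i Fi [v' _ v'v]] := bF (Phi v); first by exists v.
  by exists i => //; exists v'.
- by apply: within_closed_cells => // i /Fd; exact: ce.
Qed.

Hypothesis extC : forall n (u : disk R n -> W) (a : disk R n -> E),
  continuous u -> {within disk_boundary R n, continuous a} ->
  (forall v, disk_boundary R n v -> C (u v) (a v)) ->
  exists a', [/\ continuous a', forall v, disk_boundary R n v -> a' v = a v &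
    forall v, C (u v) (a' v)].

(** Continuity below dimension [n] is expressed through the characteristic maps; on the other cells
    only membership in [C] is asked. *)
Let skeletal_section n (e : W -> E) :=
  (forall w, C w (e w)) /\
  forall j, (d j < n)%N -> continuous (e \o @Phi j).

(** On each cell of dimension [n], the section is replaced by an extension over the disk of its
    boundary values; elsewhere it is kept. *)
Let section_step n e : skeletal_section n e ->
  exists e', skeletal_section n.+1 e' /\
    forall w, (d (cell_of w) < n)%N -> e' w = e w.
Proof.
move=> [Ce ce].
have exL j : exists L : disk R (d j) -> E, d j = n ->
    [/\ continuous L, forall v, disk_boundary R (d j) v -> L v = e (Phi v) &
      forall v, C (Phi v) (L v)].
  have [jn|jn] := eqVneq (d j) n; last first.
    by exists (fun v => e (Phi v)) => /eqP; rewrite (negbTE jn).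
  have [|||L HL] := @extC (d j) (@Phi j) (e \o @Phi j).
  - exact: cPhi.
  - by apply: boundary_within => i; rewrite jn; exact: ce.
  - by move=> v _; exact: Ce.
  by exists L.
pose L j := projT1 (cid (exL j)).
have LP j : d j = n -> [/\ continuous (L j),
      forall v, disk_boundary R (d j) v -> L j v = e (Phi v) &
      forall v, C (Phi v) (L j v)] by rewrite /L; case: cid.
(* The extensions over the disks define one map on [W], because a point of an open cell has a single
   interior preimage under its characteristic map. *)
have ex w : exists y, (forall j v, d j = n -> disk_interior R (d j) v ->
    Phi v = w -> y = L j v) /\ (d (cell_of w) <> n -> y = e w).
  have [wn|wn] := eqVneq (d (cell_of w)) n; last first.
    exists (e w); split=> // j v jn vi vw; exfalso; move/eqP: wn; apply.
    by rewrite -vw cell_of_interior.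
  have [v vi vw] := cell_ofP w; exists (L (cell_of w) v); split=> // j v' jn v'i v'w.
  have jw : cell_of w = j by rewrite -v'w cell_of_interior.
  move: v vi vw; rewrite jw => v vi vw; congr L.
  have [_ /(_ j)[inj _] _ _ _] := cw.
  by apply: inj; rewrite ?inE// vw.
pose e' w := projT1 (cid (ex w)).
have e'L j v : d j = n -> disk_interior R (d j) v -> e' (Phi v) = L j v.
  by rewrite /e'; case: cid => y [yP _] /= jn vi; exact: yP.
have e'e w : d (cell_of w) <> n -> e' w = e w.
  by rewrite /e'; case: cid => y [_ yP] /=; exact: yP.
have e'lt w : (d (cell_of w) < n)%N -> e' w = e w.
  by move=> wn; apply: e'e => wn'; rewrite wn' ltnn in wn.
exists e'; split=> //; split.
  move=> w; have [wn|wn] := eqVneq (d (cell_of w)) n; last first.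
    by rewrite e'e//; exact/eqP.
  have [v vi vw] := cell_ofP w; rewrite -{2}vw e'L// -{1}vw.
  by have [_ _] := LP _ wn; exact.
move=> j; rewrite ltnS leq_eqVlt => /orP[/eqP jn|jn]; last first.
  rewrite (_ : e' \o _ = e \o @Phi j); first exact: ce.
  by apply/funext => v /=; apply: e'lt; exact: leq_ltn_trans (closed_cell_dim v) jn.
have [cL Lb _] := LP j jn; rewrite (_ : e' \o _ = L j)//.
apply/funext => v /=; have [vi|vb] := disk_dichotomy v; first exact: e'L.
by rewrite e'lt ?Lb// -jn; exact: boundary_dim.
Qed.

(** [C w] is the set of admissible values at [w]. Sections are built skeleton by skeleton; the value
    at a point is eventually stationary, and the weak topology makes the limit continuous. *)
Lemma cw_structure_section (e00 : W -> E) :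
  exists2 e : W -> E, continuous e & forall w, C w (e w).
Proof.
have disk0 : disk R 0 0 by rewrite /disk /= /sqnorm big_ord0 ler01.
have bd0 v : ~ disk_boundary R 0 v.
  by rewrite /disk_boundary /= /sqnorm big_ord0 => /eqP; rewrite eq_sym oner_eq0.
have ex0 w : exists y, C w y.
  (* The 0-disk has empty boundary, so extending over it shows that [C w] is nonempty; [e00] only
     provides a formal boundary map. *)
  have [|||a' [_ _ Ca]] := @extC 0 (fun _ => w) (fun _ => e00 w).
  - exact: continuous_cst_fun.
  - by apply: continuous_subspaceT; exact: continuous_cst_fun.
  - by move=> v /bd0.
  by exists (a' (exist _ (0 : 'rV[R]_0) (mem_set disk0))); exact: Ca.
have [e0 Ce0] := choice ex0.
(* The step is made total for the recursion: a map that is not a section of stage [n] is left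
   unchanged. *)
have exS n e : exists e', skeletal_section n e -> skeletal_section n.+1 e' /\
    forall w, (d (cell_of w) < n)%N -> e' w = e w.
  have [se|se] := pselect (skeletal_section n e); last by exists e.
  by have [e' e'P] := section_step se; exists e'.
pose next n e := projT1 (cid (exS n e)).
pose s := fix s n := if n is m.+1 then next m (s m) else e0.
have sP n : skeletal_section n (s n).
  elim: n => [|n IHn]; first by split.
  by rewrite /= /next; case: cid => e' /= /(_ IHn)[].
have sS n w : (d (cell_of w) < n)%N -> s n.+1 w = s n w.
  by rewrite /= /next; case: cid => e' /= /(_ (sP n))[_]; exact.
(* Stage [n] controls cells of dimension less than [n], whence the successor. *)
pose e w := s (d (cell_of w)).+1 w.
have se n w : (d (cell_of w) < n)%N -> s n w = e w.
  elim: n => // n IHn; rewrite ltnS leq_eqVlt => /orP[/eqP <-//|wn].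
  by rewrite sS// IHn.
exists e; last by move=> w; rewrite /e; have [Cs _] := sP (d (cell_of w)).+1.
apply/continuous_closedP => A cA; have [_ _ _ _ wt] := cw.
apply: wt => j; have [_ /(_ j (ltnSn _))/continuous_closedP cs] := sP (d j).+1.
rewrite (_ : _ @^-1` _ = (s (d j).+1 \o @Phi j) @^-1` A); first exact: cs.
apply/funext => v; rewrite /preimage /comp /= -[e _](se (d j).+1)// ltnS.
exact: closed_cell_dim.
Qed.

End CWSections.

(** * Whitehead's theorem *)

Lemma hausdorff_prod (T U : topologicalType) :
  hausdorff_space T -> hausdorff_space U -> hausdorff_space (T * U)%type.
Proof.
move=> hT hU x y xy; rewrite (surjective_pairing x) (surjective_pairing y).
congr pair; [apply: hT => A B nA nB|apply: hU => A B nA nB].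
  have [||z [zA zB]] := xy (fst @^-1` A) (fst @^-1` B).
  - exact: continuous_fst.
  - exact: continuous_fst.
  by exists z.1.
have [||z [zA zB]] := xy (snd @^-1` A) (snd @^-1` B).
- exact: continuous_snd.
- exact: continuous_snd.
by exists z.2.
Qed.

Section Whitehead.
Variables (R : realType) (X Y : topologicalType) (h : X -> Y).
Hypothesis wh : weak_homotopy_equivalence R h.
Local Notation I := (unit_interval R).

Let ch : continuous h. Proof. by case: wh. Qed.
Let cI := @compact_unit_interval R.
Let hI := @hausdorff_unit_interval R.

Let cI2 : compact [set: I * I].
Proof. by rewrite -setXTT; exact: compact_setX. Qed.

Let hI2 : hausdorff_space (I * I)%type.
Proof. exact: hausdorff_prod. Qed.

(* The section takes values in the mapping path space of h. *)
Lemma whitehead_right_inverse : cw_complex R Y ->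
  exists (k : Y -> X) (K : Y * I -> Y), [/\ continuous k, continuous K,
    forall y, K (y, I0) = h (k y) & forall y, K (y, I1) = y].
Proof.
move=> [hausY [J [d [Phi cw]]]].
pose E : topologicalType := (X * {compact-open, I -> Y})%type.
(* A point of [X] with a path from its image to [y]. Continuity is imposed because the function
   space contains all functions. *)
pose C (y : Y) : set E := [set z | [/\ continuous (z.2 : I -> Y),
  (z.2 : I -> Y) I0 = h z.1 & (z.2 : I -> Y) I1 = y]].
have [_ [_ surj] _] := wh.
have e00 (y : Y) : E.
  by have [x _] := cid (surj y); exact: (x, fun _ => y).
have [||e ce Ce] := @cw_structure_section R Y E C _ J d Phi cw _ e00 => //.
  move=> n u a cu ca Ca.
  have ca1 : {within disk_boundary R n, continuous (fst \o a)}.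
    apply: (@within_comp _ _ _ _ setT _ fst) => //.
    by apply: continuous_subspaceT; exact: continuous_fst.
  have ca2 : {within disk_boundary R n, continuous (snd \o a)}.
    apply: (@within_comp _ _ _ _ setT _ snd) => //.
    by apply: continuous_subspaceT; exact: continuous_snd.
  have [||a' [G [ca' cG a'a G01 Gp]]] := @has_lifting_disk _ _ _ _ wh n (fst \o a) u
      (fun z => ((a z.1).2 : I -> Y) z.2) ca1 cu.
  - apply: (within_uncurry_compact cI hI ca2).
    by move=> v /Ca[].
  - by move=> v /Ca[_ a0 a1].
  exists (fun v => (a' v, (fun t => G (v, t)) : {compact-open, I -> Y})); split.
  - by apply: continuous_pair => //; exact: continuous_curry_compact_open.
  - move=> v vb; rewrite [RHS]surjective_pairing; congr pair; first exact: a'a.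
    by apply/funext => t; rewrite Gp.
  - move=> v; have [G0 G1] := G01 v; split=> //=.
    exact: continuous_slice.
exists (fst \o e), (fun z => ((e z.1).2 : I -> Y) z.2); split.
- by apply: continuous_comp_fun => //; exact: continuous_fst.
- apply: (@continuous_uncurry_compact _ _ _ (snd \o e)) => //.
    by apply: continuous_comp_fun => //; exact: continuous_snd.
  by move=> y; have [] := Ce y.
- by move=> y; have [_ ? _] := Ce y.
- by move=> y; have [_ _ ?] := Ce y.
Qed.

(* The section takes values in paths of X together with squares of Y. *)
Lemma whitehead_homotopy_lift (W : topologicalType) (p0 p1 : W -> X)
    (N : W * I -> Y) :
  cw_complex R W -> continuous p0 -> continuous p1 -> continuous N ->
  (forall w, N (w, I0) = h (p0 w)) -> (forall w, N (w, I1) = h (p1 w)) ->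
  exists F : W * I -> X, [/\ continuous F, forall w, F (w, I0) = p0 w &
    forall w, F (w, I1) = p1 w].
Proof.
move=> [hausW [J [d [Phi cw]]]] cp0 cp1 cN N0 N1.
pose E : topologicalType :=
  ({compact-open, I -> X} * {compact-open, I * I -> Y})%type.
(* A path in [X] from [p0 w] to [p1 w], with a square in [Y] that deforms its image into the path
   [N (w, _)] while keeping the end points fixed. *)
pose C (w : W) : set E := [set z | [/\ continuous (z.1 : I -> X),
    continuous (z.2 : I * I -> Y),
    (z.1 : I -> X) I0 = p0 w /\ (z.1 : I -> X) I1 = p1 w,
    forall t, (z.2 : I * I -> Y) (t, I0) = h ((z.1 : I -> X) t) /\
      (z.2 : I * I -> Y) (t, I1) = N (w, t) &
    forall s, (z.2 : I * I -> Y) (I0, s) = h (p0 w) /\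
      (z.2 : I * I -> Y) (I1, s) = h (p1 w)]].
pose e00 (w : W) : E := (fun _ => p0 w, fun _ => h (p0 w)).
have I10 : (I1 == I0 :> I) = false by rewrite eq_sym (negbTE (I0_neq_I1 R)).
have [||e ce Ce] := @cw_structure_section R W E C _ J d Phi cw _ e00 => //.
  move=> n u a cu ca Ca; pose B : topologicalType := disk R n.
  have ca1 : {within disk_boundary R n, continuous (fst \o a)}.
    apply: (@within_comp _ _ _ _ setT _ fst) => //.
    by apply: continuous_subspaceT; exact: continuous_fst.
  have ca2 : {within disk_boundary R n, continuous (snd \o a)}.
    apply: (@within_comp _ _ _ _ setT _ snd) => //.
    by apply: continuous_subspaceT; exact: continuous_snd.
  pose q := fun z : B * (I * I) => ((a z.1).2 : I * I -> Y) z.2.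
  (* On the two ends the given maps replace the values of [a], which are known to be correct only
     over the boundary of the disk. *)
  pose b (x : B * I) : X := if x.2 == I0 then p0 (u x.1) else
    if x.2 == I1 then p1 (u x.1) else ((a x.1).1 : I -> X) x.2.
  pose p (x : B * I * I) : Y := if x.1.2 == I0 then h (p0 (u x.1.1)) else
    if x.1.2 == I1 then h (p1 (u x.1.1)) else q (x.1.1, (x.1.2, x.2)).
  have b0 v : b (v, I0) = p0 (u v) by rewrite /b eqxx.
  have b1 v : b (v, I1) = p1 (u v) by rewrite /b /= I10 eqxx.
  have ba v t : disk_boundary R n v -> b (v, t) = ((a v).1 : I -> X) t.
    move=> /Ca[_ _ [a0 a1] _ _]; rewrite /b /=.
    by case: eqP => [->//|_]; case: eqP => [->|].
  have p_0 v s : p (v, I0, s) = h (p0 (u v)) by rewrite /p eqxx.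
  have p_1 v s : p (v, I1, s) = h (p1 (u v)) by rewrite /p /= I10 eqxx.
  have pa v t s : disk_boundary R n v ->
      p (v, t, s) = ((a v).2 : I * I -> Y) (t, s).
    move=> /Ca[_ _ _ _ a01]; rewrite /p /=; have [a0 a1] := a01 s.
    by case: eqP => [->//|_]; case: eqP => [->|].
  have c1 : continuous (fun x : B * I => x.1) by exact: continuous_fst.
  have c2 : continuous (fun x : B * I => x.2) by exact: continuous_snd.
  have c22 : continuous (fun x : B * I * I => x.2) by exact: continuous_snd.
  have c11 : continuous (fun x : B * I * I => x.1.1).
    by apply: continuous_comp_fun; exact: continuous_fst.
  have c12 : continuous (fun x : B * I * I => x.1.2).
    by apply: (continuous_comp_fun (@continuous_snd _ _)); exact: continuous_fst.
  have cb : closed (@disk_boundary R n) by exact: closed_disk_boundary.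
  have cwb : {within prism_boundary R (@disk_boundary R n), continuous b}.
    rewrite (_ : prism_boundary R _ = [set x : B * I | disk_boundary R n x.1] `|`
        ([set x | x.2 = I0] `|` [set x | x.2 = I1])); last first.
      apply/seteqP; split=> x.
        by case=> ?; [left|right; left|right; right].
      by case=> [?|[?|?]]; [constructor 1|constructor 2|constructor 3].
    apply: (@within_glue _ _ _ _ (fun x => ((a x.1).1 : I -> X) x.2) b) => //.
    - exact: (@closed_cylinder B _ (@disk_boundary R n) fst c1 cb).
    - by apply: closedU; exact: closed_fiber.
    - have := within_uncurry_compact cI hI ca1; rewrite setXT; apply.
      by move=> v /Ca[].
    - apply: (@within_glue _ _ _ _ (fun x => p0 (u x.1)) (fun x => p1 (u x.1))).
      + exact: closed_fiber.
      + exact: closed_fiber.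
      + apply: continuous_subspaceT; apply: (continuous_comp_fun cp0).
        exact: continuous_comp_fun.
      + apply: continuous_subspaceT; apply: (continuous_comp_fun cp1).
        exact: continuous_comp_fun.
      + by move=> [v t] /= ->.
      + by move=> [v t] /= ->.
    - by move=> [v t] /= vb; rewrite ba.
  have cwp : {within prism_boundary R (@disk_boundary R n) `*` setT, continuous p}.
    rewrite (_ : _ `*` _ = [set x : B * I * I | disk_boundary R n x.1.1] `|`
        ([set x | x.1.2 = I0] `|` [set x | x.1.2 = I1])); last first.
      apply/seteqP; split=> x.
        by case=> -[?|?|?] _; [left|right; left|right; right].
      by case=> [?|[?|?]]; split=> //; [constructor 1|constructor 2|constructor 3].
    apply: (@within_glue _ _ _ _ (q \o fun x => (x.1.1, (x.1.2, x.2))) p) => //.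
    - exact: (@closed_cylinder B _ (@disk_boundary R n) (fun x => x.1.1) c11 cb).
    - by apply: closedU; exact: closed_fiber.
    - apply: (@within_comp _ _ _ _ (disk_boundary R n `*` setT)).
      + apply: continuous_subspaceT; apply: continuous_pair => //.
        exact: continuous_pair.
      + by move=> x.
      + apply: (within_uncurry_compact cI2 hI2 ca2).
        by move=> v /Ca[].
    - apply: (@within_glue _ _ _ _ (h \o p0 \o u \o (fun x => x.1.1))
          (h \o p1 \o u \o (fun x => x.1.1))).
      + exact: closed_fiber.
      + exact: closed_fiber.
      + apply: continuous_subspaceT; apply: continuous_comp_fun => //.
        by do 2?apply: continuous_comp_fun => //.
      + apply: continuous_subspaceT; apply: continuous_comp_fun => //.
        by do 2?apply: continuous_comp_fun => //.
      + by move=> [[v t] s] /= ->.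
      + by move=> [[v t] s] /= ->.
    - by move=> [[v t] s] /= vb; rewrite pa.
  have cNu : continuous (fun x : B * I => N (u x.1, x.2)).
    apply: (continuous_comp_fun cN); apply: continuous_pair => //.
    exact: continuous_comp_fun.
  have [|a' [G [ca' cG a'b G01 Gp]]] :=
      @has_lifting_disk_prism _ _ _ _ wh n b _ p cwb cNu cwp.
    move=> [v t] [/= vb|/= ->|/= ->].
    - rewrite !pa//= ba//.
      by have [_ _ _ /(_ t)] := Ca _ vb.
    - by rewrite !p_0 b0 N0.
    - by rewrite !p_1 b1 N1.
  exists (fun v => ((fun t => a' (v, t)) : {compact-open, I -> X},
    (fun ts => G (v, ts.1, ts.2)) : {compact-open, (I * I)%type -> Y})).
  have cG' : continuous (G \o fun x : B * (I * I) => (x.1, x.2.1, x.2.2)).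
    apply: (continuous_comp_fun cG); apply: continuous_pair; last first.
      by apply: (continuous_comp_fun (@continuous_snd _ _)); exact: continuous_snd.
    apply: continuous_pair; first exact: continuous_fst.
    by apply: (continuous_comp_fun (@continuous_fst _ _)); exact: continuous_snd.
  split.
  - apply: continuous_pair; first exact: continuous_curry_compact_open.
    exact: (continuous_curry_compact_open cG').
  - move=> v vb; rewrite [RHS]surjective_pairing; congr pair; apply/funext.
      by move=> t; rewrite a'b ?ba//; constructor 1.
    by move=> [t s]; rewrite /= Gp ?pa//; constructor 1.
  - move=> v; split=> /=.
    + exact: continuous_slice.
    + exact: (@continuous_slice B (I * I)%type Y _ v cG').
    + by rewrite !a'b ?b0 ?b1//; [constructor 3|constructor 2].
    + by move=> t; have [] := G01 (v, t).
    + move=> s; rewrite !Gp; [|by constructor 3|by constructor 2].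
      by rewrite p_0 p_1.
exists (fun z => ((e z.1).1 : I -> X) z.2); split.
- apply: (@continuous_uncurry_compact _ _ _ (fst \o e)) => //.
    by apply: continuous_comp_fun => //; exact: continuous_fst.
  by move=> w; have [] := Ce w.
- by move=> w; have [_ _ [? _] _ _] := Ce w.
- by move=> w; have [_ _ [_ ?] _ _] := Ce w.
Qed.

(** The homotopy [K (h x, t)] joins [h \o k \o h] to [h]; lifting it through [h] joins [k \o h] to
    the identity. *)
Theorem whitehead : cw_complex R X -> cw_complex R Y ->
  exists (k : Y -> X) (K1 : X * I -> X) (K2 : Y * I -> Y),
    [/\ continuous k, continuous K1, continuous K2,
      forall x, K1 (x, I0) = k (h x) /\ K1 (x, I1) = x &
      forall y, K2 (y, I0) = h (k y) /\ K2 (y, I1) = y].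
Proof.
move=> cwX /whitehead_right_inverse[k [K [ck cK K0 K1]]].
have [|||||F [cF F0 F1]] := @whitehead_homotopy_lift X (k \o h) id
    (fun z => K (h z.1, z.2)) cwX.
- exact: continuous_comp_fun.
- by move=> x; exact: cvg_id.
- apply: (continuous_comp_fun cK); apply: continuous_pair.
    by apply: continuous_comp_fun => //; exact: continuous_fst.
  exact: continuous_snd.
- by move=> x; rewrite K0.
- by move=> x; rewrite K1.
by exists k, F, K; split.
Qed.

End Whitehead.

(** * Globes and execution paths *)

Section Globes.
Variable R : realType.
Local Notation I := (unit_interval R).
Implicit Types T X Y : topologicalType.

Lemma glob_classP X (x x' : X) (t t' : I) :
  glob_class x t = glob_class x' t' <->
  [\/ (x, t) = (x', t'), t = I0 /\ t' = I0 | t = I1 /\ t' = I1].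
Proof.
rewrite /glob_class; split.
  move=> /eqmodP; rewrite /= /glob_rel /=.
  move=> /or3P[/eqP ?|/andP[/eqP ? /eqP ?]|/andP[/eqP ? /eqP ?]].
  - by constructor 1.
  - by constructor 2.
  - by constructor 3.
move=> h; apply/eqmodP; rewrite /= /glob_rel /=.
by case: h => [->|[-> ->]|[-> ->]]; rewrite !eqxx ?orbT.
Qed.

Lemma glob_class_surj X (z : Glob R X) : exists x t, z = glob_class x t.
Proof. by exists (repr z).1, (repr z).2; rewrite /glob_class -surjective_pairing reprK. Qed.

Lemma continuous_glob_class T X (x : T -> X) (t : T -> I) :
  continuous x -> continuous t -> continuous (fun s => glob_class (x s) (t s)).
Proof.
move=> cx ct.
apply: (@continuous_comp_fun _ _ _ (\pi_(Glob R X)%qT)); first exact: pi_continuous.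
exact: continuous_pair.
Qed.

Lemma continuous_from_glob X T (f : Glob R X -> T) :
  continuous (fun z : X * I => f (glob_class z.1 z.2)) -> continuous f.
Proof.
move=> cf; apply/quotient_continuous.
rewrite (_ : _ \o _ = fun z : X * I => f (glob_class z.1 z.2))//.
by apply/funext => -[x t].
Qed.

(** The product of a quotient map with the interval is again a quotient map: [I] being compact
    Hausdorff, the factor [I] is curried away before the universal property is applied. *)
Lemma continuous_from_glob_prod X T (f : Glob R X * I -> T) :
  continuous (fun z : X * I * I => f (glob_class z.1.1 z.1.2, z.2)) ->
  continuous f.
Proof.
move=> cf; pose F (z : Glob R X) : {compact-open, I -> T} := fun u => f (z, u).
rewrite (_ : f = fun z => (F z.1 : I -> T) z.2); last by apply/funext => -[].
apply: continuous_uncurry_compact.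
- exact: compact_unit_interval.
- exact: hausdorff_unit_interval.
- apply: continuous_from_glob.
  exact: (continuous_curry_compact_open cf).
- move=> z; have [x [t ->]] := glob_class_surj z.
  exact: (@continuous_slice (X * I)%type I T _ (x, t) cf).
Qed.

(** Independent of the chosen representative by [heightE], unlike the base point, which is lost at
    the two poles. *)
Definition height X (z : Glob R X) : I := (repr z).2.
Arguments height {X} z.

Lemma glob_class_repr X (z : Glob R X) : glob_class (repr z).1 (height z) = z.
Proof. by rewrite /glob_class /height -surjective_pairing reprK. Qed.

Lemma heightE X (x : X) (t : I) : height (glob_class x t) = t.
Proof.
by have /glob_classP[[_ ->]|[-> ->]|[-> ->]] := glob_class_repr (glob_class x t).
Qed.

Lemma continuous_height X : continuous (@height X).
Proof.
apply: continuous_from_glob; under eq_fun do rewrite heightE.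
exact: continuous_snd.
Qed.

Lemma iotaP X (z : Glob R X) : Defs.iota z <-> height z = I0.
Proof.
split=> [[x _ <-]|]; first by rewrite heightE.
by have [x [t ->]] := glob_class_surj z; rewrite heightE => ->; exists x.
Qed.

Lemma sigmaP X (z : Glob R X) : sigma z <-> height z = I1.
Proof.
split=> [[x _ <-]|]; first by rewrite heightE.
by have [x [t ->]] := glob_class_surj z; rewrite heightE => ->; exists x.
Qed.

Lemma glob_class0 X (x : X) (z : Glob R X) : height z = I0 -> z = glob_class x I0.
Proof.
have [x' [t ->]] := glob_class_surj z; rewrite heightE => ->.
by apply/glob_classP; constructor 2.
Qed.

Lemma glob_class1 X (x : X) (z : Glob R X) : height z = I1 -> z = glob_class x I1.
Proof.
have [x' [t ->]] := glob_class_surj z; rewrite heightE => ->.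
by apply/glob_classP; constructor 3.
Qed.

Lemma glob_class_inj X (x x' : X) (t t' : I) : t <> I0 -> t <> I1 ->
  glob_class x t = glob_class x' t' -> x = x' /\ t = t'.
Proof. by move=> t0 t1 /glob_classP[[-> ->]|[]|[]]. Qed.

Definition is_reparam (phi : I -> I) : Prop :=
  [/\ forall s s' : I, set_val s <= set_val s' -> set_val (phi s) <= set_val (phi s'),
      phi I0 = I0 & phi I1 = I1].

Lemma exec_path_class X (x : X) (phi : I -> I) :
  continuous phi -> is_reparam phi -> exec_path (fun s => glob_class x (phi s)).
Proof.
move=> cphi [mphi phi0 phi1]; split.
- by apply: continuous_glob_class => //; exact: continuous_cst_fun.
- by move=> s s' ss'; exists x, (phi s), (phi s'); split=> //; exact: mphi.
- by apply/iotaP; rewrite heightE.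
- by apply/sigmaP; rewrite heightE.
Qed.

Definition halfI : I := clamp (2^-1).

Lemma halfIE : set_val halfI = 2^-1.
Proof. by rewrite clampE//; apply/andP; split; lra. Qed.

Lemma halfI_neq0 : halfI <> I0.
Proof. by move=> /(congr1 set_val); rewrite halfIE I0E; lra. Qed.

Lemma halfI_neq1 : halfI <> I1.
Proof. by move=> /(congr1 set_val); rewrite halfIE I1E; lra. Qed.

Lemma unit_interval_IVT (phi : I -> I) : continuous phi ->
  phi I0 = I0 -> phi I1 = I1 -> exists s, phi s = halfI.
Proof.
move=> cphi p0 p1; pose g (r : R) : R := set_val (phi (clamp r)).
have cg : continuous g.
  apply: (@continuous_comp_fun _ _ _ set_val); first exact: continuous_set_val.
  by apply: continuous_comp_fun => //; exact: continuous_clamp.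
have c0 : clamp (0 : R) = I0.
  by apply: unit_interval_inj; rewrite clampE ?I0E// lexx ler01.
have c1 : clamp (1 : R) = I1.
  by apply: unit_interval_inj; rewrite clampE ?I1E// lexx ler01.
have [||r _ gr] := @IVT R g 0 1 2^-1 ler01.
- exact: continuous_subspaceT.
- rewrite /g c0 c1 p0 p1 I0E I1E ge_min le_max.
  by apply/andP; split; apply/orP; [left|right]; lra.
by exists (clamp r); apply: unit_interval_inj; rewrite halfIE.
Qed.

(** The base point is read where the height is 1/2. Every other value is comparable with that one,
    so both are classes over one point, which the class at height 1/2 determines. *)
Lemma exec_path_decomposition Y (gamma : I -> Glob R Y) : exec_path gamma ->
  exists2 y, is_reparam (height \o gamma) &
    forall s, gamma s = glob_class y (height (gamma s)).
Proof.
move=> [cg mg /iotaP g0 /sigmaP g1].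
have mh (s s' : I) : set_val s <= set_val s' ->
    set_val (height (gamma s)) <= set_val (height (gamma s')).
  by move=> /mg[y [t [t' [tt' -> ->]]]]; rewrite !heightE.
have [||| s0 hs0] := @unit_interval_IVT (height \o gamma) => //.
  by apply: continuous_comp_fun => //; exact: continuous_height.
have [y [t yt]] := glob_class_surj (gamma s0).
have t2 : t = halfI by rewrite -hs0 /= yt heightE.
exists y; first by split.
have key s x t1 t1' : glob_class x t1 = gamma s0 -> gamma s = glob_class x t1' ->
    gamma s = glob_class y (height (gamma s)).
  rewrite yt t2 => /esym /(glob_class_inj halfI_neq0 halfI_neq1)[-> _] ->.
  by rewrite heightE.
move=> s; have /orP[ss0|s0s] := le_total (set_val s) (set_val s0).
  by have [x [u [u' [_ gs gs0]]]] := mg _ _ ss0; exact: (key s x u' u).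
by have [x [u [u' [_ gs0 gs]]]] := mg _ _ s0s; exact: (key s x u u').
Qed.

(* A continuous family of execution paths has a continuous base point: near a
   parameter where the height is 1/2 the class determines the point. *)
Lemma continuous_base T Y (gamma : T -> I -> Glob R Y) (y : T -> Y)
    (phi : T -> I -> I) :
  (forall s, continuous (fun z => gamma z s)) ->
  (forall z s, gamma z s = glob_class (y z) (phi z s)) ->
  (forall z, exists s, phi z s = halfI) -> continuous y.
Proof.
move=> cg gE half z V; rewrite nbhsE => -[O [oO Oy] OV].
have [s zs] := half z.
pose U : set (Glob R Y) := [set w | exists2 x, O x & exists2 t : I,
  t <> I0 /\ t <> I1 & w = glob_class x t].
have oU : open U.
  rewrite /open /= /quotient_open.
  rewrite (_ : _ @^-1` _ = (fst @^-1` O) `&` (snd @^-1` (~` ([set I0] `|` [set I1])))).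
    apply: openI.
      by have /continuousP c := @continuous_fst Y I; exact: c.
    have /continuousP c := @continuous_snd Y I; apply: c; rewrite openC.
    by apply: closedU; exact: closed_unit_interval1.
  apply/seteqP; split=> -[x t] /=.
    move=> [x' Ox' [t' [t'0 t'1] /esym/(glob_class_inj t'0 t'1)[<- <-]]].
    by split=> // -[].
  move=> [Ox t01]; exists x => //; exists t => //.
  by split=> ?; apply: t01; [left|right].
have : nbhs z ((fun z => gamma z s) @^-1` U).
  apply: cg; apply: open_nbhs_nbhs; split=> //.
  exists (y z) => //; exists halfI; rewrite ?gE ?zs//.
  by split; [exact: halfI_neq0|exact: halfI_neq1].
apply: filterS => w [x Ox [t [t0 t1]]]; rewrite gE => /esym.
by move=> /(glob_class_inj t0 t1)[xw _]; apply: OV; rewrite /= -xw.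
Qed.

Lemma is_reparam_id : is_reparam (@id I). Proof. by split. Qed.

Lemma is_reparam_mix (u : I) (phi psi : I -> I) :
  is_reparam phi -> is_reparam psi -> is_reparam (fun s => mix u (phi s) (psi s)).
Proof.
move=> [mphi p0 p1] [mpsi q0 q1]; split; [|by rewrite p0 q0 mixxx|by rewrite p1 q1 mixxx].
move=> s s' ss'; rewrite !mixE; have /andP[u0 u1] := unit_interval_bounds u.
apply: lerD; apply: ler_wpM2l => //; [by rewrite subr_ge0|exact: mphi|exact: mpsi].
Qed.

Lemma glob_morphism_class X Y (F : Glob R X -> Glob R Y) (a : X -> Y)
    (phi : X -> I -> I) :
  continuous F -> (forall x t, F (glob_class x t) = glob_class (a x) (phi x t)) ->
  (forall x, is_reparam (phi x)) -> is_glob_morphism F.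
Proof.
move=> cF FE rphi; have hF z : height z = I0 -> height (F z) = I0.
  have [x [t ->]] := glob_class_surj z; rewrite FE !heightE => ->.
  by have [] := rphi x.
have hF1 z : height z = I1 -> height (F z) = I1.
  have [x [t ->]] := glob_class_surj z; rewrite FE !heightE => ->.
  by have [] := rphi x.
split=> //.
  move=> _ [z [/iotaP z0|/sigmaP z1] <-]; [left; apply/iotaP|right; apply/sigmaP].
    exact: hF.
  exact: hF1.
move=> gamma [cg mg /iotaP g0 /sigmaP g1]; split.
- exact: continuous_comp_fun.
- move=> s s' /mg[x [t [t' [tt' gs gs']]]].
  exists (a x), (phi x t), (phi x t'); rewrite /= gs gs' !FE; split=> //.
  by have [m _ _] := rphi x; exact: m.
- by apply/iotaP; exact: hF.
- by apply/sigmaP; exact: hF1.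
Qed.

(** The path [t] to [glob_class x t] is an execution path, so its image has a single base point,
    taken as [h x]. *)
Lemma glob_morphism_decomposition X Y (f : glob_morphism R X Y) :
  exists h : X -> Y, [/\ continuous h,
    forall x, is_reparam (fun t => height (f (glob_class x t))) &
    forall x t, f (glob_class x t) = glob_class (h x) (height (f (glob_class x t)))].
Proof.
have [cf _ pf] := glob_morphismP f.
have cid x : exec_path (fun t : I => glob_class (x : X) t).
  have ci : continuous (@id I) by move=> t; exact: cvg_id.
  exact: (exec_path_class x ci is_reparam_id).
have ex x : exists y, is_reparam (fun t => height (f (glob_class x t))) /\
    forall t, f (glob_class x t) = glob_class y (height (f (glob_class x t))).
  by have [y ry yE] := exec_path_decomposition (pf _ (cid x)); exists y.
have [h hP] := choice ex; exists h; split; [|by move=> x; have [] := hP x|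
  by move=> x; have [] := hP x].
apply: (@continuous_base _ _ (fun x t => f (glob_class x t)) _
  (fun x t => height (f (glob_class x t)))).
- move=> t; apply: continuous_comp_fun => //; apply: continuous_glob_class.
    by move=> x; exact: cvg_id.
  exact: continuous_cst_fun.
- by move=> x; have [] := hP x.
- move=> x; have [[_ p0 p1] _] := hP x; apply: unit_interval_IVT => //.
  apply: continuous_comp_fun; first exact: continuous_height.
  apply: continuous_comp_fun => //.
  by have [] := cid x.
Qed.

(** The base point moves along [K] while the parametrisation is interpolated linearly with the
    identity. *)
Lemma S_homotopic_class X (F : Glob R X -> Glob R X) (a : X -> X)
    (phi : X -> I -> I) (K : X * I -> X) :
  continuous (fun z : X * I => phi z.1 z.2) ->
  (forall x t, F (glob_class x t) = glob_class (a x) (phi x t)) ->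
  (forall x, is_reparam (phi x)) ->
  continuous K -> (forall x, K (x, I0) = a x /\ K (x, I1) = x) ->
  S_homotopic F idfun.
Proof.
move=> cphi FE rphi cK K01.
pose H (z : Glob R X * I) :=
  glob_class (K ((repr z.1).1, z.2)) (mix z.2 (phi (repr z.1).1 (height z.1)) (height z.1)).
have HE x t u : H (glob_class x t, u) = glob_class (K (x, u)) (mix u (phi x t) t).
  rewrite /H /=; have /glob_classP := glob_class_repr (glob_class x t).
  (* At the poles the chosen representative may lie over another point, but both reparametrisations
     fix 0 and 1, so the class is the same. *)
  set x' := (repr _).1; rewrite heightE => -[[->//]|[-> _]|[-> _]].
    apply/glob_classP; constructor 2.
    by have [_ -> _] := rphi x; have [_ -> _] := rphi x'; rewrite mixxx.
  apply/glob_classP; constructor 3.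
  by have [_ _ ->] := rphi x; have [_ _ ->] := rphi x'; rewrite mixxx.
have c11 : continuous (fun z : X * I * I => z.1.1).
  by apply: continuous_comp_fun; exact: continuous_fst.
have c12 : continuous (fun z : X * I * I => z.1.2).
  by apply: (continuous_comp_fun (@continuous_snd _ _)); exact: continuous_fst.
have c2 : continuous (fun z : X * I * I => z.2) by exact: continuous_snd.
have cH : continuous H.
  apply: continuous_from_glob_prod; under eq_fun do rewrite HE.
  apply: continuous_glob_class.
    by apply: (continuous_comp_fun cK); exact: continuous_pair.
  apply: continuous_mix => //.
  apply: (@continuous_comp_fun _ _ _ (fun z : X * I => phi z.1 z.2)) => //.
  exact: continuous_fst.
exists H; split=> //.
- move=> z; have [x [t ->]] := glob_class_surj z.
  by rewrite HE mix0 FE; have [-> _] := K01 x.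
- move=> z; have [x [t ->]] := glob_class_surj z.
  by rewrite HE mix1; have [_ ->] := K01 x.
- move=> u; apply: (@glob_morphism_class _ _ _ (fun x => K (x, u))
      (fun x t => mix u (phi x t) t)).
  + apply: continuous_comp_fun => //; apply: continuous_pair.
      by move=> x; exact: cvg_id.
    exact: continuous_cst_fun.
  + by move=> x t; rewrite HE.
  + by move=> x; apply: is_reparam_mix => //; exact: is_reparam_id.
Qed.

End Globes.

(** * Continuity into and out of a Kelleyfication *)

Section KelleyContinuity.
Implicit Types T Z : topologicalType.

(** The map factors through its compact image, on which Kelley-open sets have open traces. *)
Lemma continuous_to_kelley T Z (g : T -> Z) :
  compact [set: T] -> continuous g -> continuous (g : T -> kelley Z).
Proof.
move=> cT cg; apply/continuousP => A oA; pose K : set Z := range g.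
have cK : compact K by apply: continuous_compact => //; exact: continuous_subspaceT.
have gK t : K (g t) by exists t.
pose g' (t : T) : K := exist _ (g t) (mem_set (gK t)).
have cg' : continuous g' by exact: continuous_to_set_type.
have /continuousP /(_ _ (oA K cK)) := cg'.
by congr open.
Qed.

(** The Kelleyfication refines the original topology. *)
Lemma continuous_from_kelley T Z (g : Z -> T) :
  continuous g -> continuous (g : kelley Z -> T).
Proof.
move=> /continuousP cg; apply/continuousP => A oA.
have: kelley_open (g @^-1` A : set (kelley Z)); last by [].
move=> K _; have /continuousP c := @continuous_set_val Z K.
by apply: c; exact: cg.
Qed.

Lemma continuous_eval_at T Z (t : T) :
  continuous (fun g : {compact-open, T -> Z} => (g : T -> Z) t).
Proof.
apply/continuousP => A oA.
rewrite (_ : _ @^-1` _ = [set g : {compact-open, T -> Z} | (g : T -> Z) @` [set t] `<=` A]).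
  by apply: compact_open_open => //; exact: compact_set1.
apply/seteqP; split=> g /=; first by move=> Agt _ [_ -> <-].
by apply; exists t.
Qed.

End KelleyContinuity.

(** * Families of execution paths and their base points *)

Section ExecutionPathSpace.
Variables (R : realType) (Y : topologicalType) (alpha beta : Glob R Y).
Hypotheses (ha : height alpha = I0) (hb : height beta = I1).
Local Notation I := (unit_interval R).

Section FamilyOfPaths.
Variables (T : topologicalType) (y : T -> Y) (psi : T * I -> I).
Hypotheses (cy : continuous y) (cpsi : continuous psi).
Hypothesis rpsi : forall z, is_reparam (fun s => psi (z, s)).

Lemma path_family_subproof z :
  exec_path_set alpha beta (fun s => glob_class (y z) (psi (z, s))).
Proof.
split.
- apply: exec_path_class => //; exact: continuous_slice.
- by have [_ -> _] := rpsi z; rewrite (glob_class0 (y z) ha).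
- by have [_ _ ->] := rpsi z; rewrite (glob_class1 (y z) hb).
Qed.

Definition path_family (z : T) : exec_path_space alpha beta :=
  exist _ (fun s => glob_class (y z) (psi (z, s))) (mem_set (path_family_subproof z))
  : exec_path_set alpha beta.

(** Currying gives continuity for the compact-open topology; compactness of the parameter space
    passes it to the Kelleyfication. *)
Lemma continuous_path_family : compact [set: T] -> continuous path_family.
Proof.
move=> cT; apply: continuous_to_kelley => //; apply: continuous_to_set_type.
apply: (@continuous_curry_compact_open _ _ _
  (fun z : T * I => glob_class (y z.1) (psi z))).
apply: continuous_glob_class => //.
by apply: continuous_comp_fun => //; exact: continuous_fst.
Qed.

End FamilyOfPaths.

Definition path_val (gamma : exec_path_space alpha beta) : I -> Glob R Y :=
  set_val (gamma : exec_path_set alpha beta).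

Lemma path_family_val (T : topologicalType) (y : T -> Y) (psi : T * I -> I)
    (cpsi : continuous psi) (rpsi : forall z, is_reparam (fun s => psi (z, s))) z s :
  path_val (path_family y cpsi rpsi z) s = glob_class (y z) (psi (z, s)).
Proof. by []. Qed.

Lemma path_val_inj : injective path_val.
Proof. by move=> g g' gg'; apply: val_inj. Qed.

Lemma path_valP gamma : exec_path_set alpha beta (path_val gamma).
Proof. exact: (set_valP (gamma : exec_path_set alpha beta)). Qed.

Lemma path_val_half gamma : exists s, height (path_val gamma s) = halfI R.
Proof.
have [eg _ _] := path_valP gamma; have [_ [_ p0 p1] _] := exec_path_decomposition eg.
apply: (unit_interval_IVT _ p0 p1).
apply: continuous_comp_fun; first exact: continuous_height.
by case: eg.
Qed.

(** The projection of a path space to base points. The last clause computes it: any base point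
    describing the path is the chosen one, as seen at height 1/2. *)
Lemma path_base : exists r : exec_path_space alpha beta -> Y, [/\ continuous r,
  forall gamma s, path_val gamma s = glob_class (r gamma) (height (path_val gamma s)) &
  forall gamma y (theta : I -> I),
    (forall s, path_val gamma s = glob_class y (theta s)) -> r gamma = y].
Proof.
have ex gamma : exists y, forall s,
    path_val gamma s = glob_class y (height (path_val gamma s)).
  have [eg _ _] := path_valP gamma.
  by have [y _ yE] := exec_path_decomposition eg; exists y.
have [r rP] := choice ex; exists r; split=> //.
  apply: continuous_from_kelley.
  apply: (@continuous_base R (exec_path_set alpha beta) Y
    (fun z s => set_val z s) r (fun z s => height (set_val z s))).
  - move=> s.
    apply: (@continuous_comp_fun _ _ _ (fun g : {compact-open, I -> Glob R Y} => g s)).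
      exact: continuous_eval_at.
    exact: continuous_set_val.
  - exact: rP.
  - exact: path_val_half.
move=> gamma y theta gE; have [s hs] := path_val_half gamma.
have := rP gamma s; rewrite {1}gE hs => /esym.
by move=> /(glob_class_inj (@halfI_neq0 R) (@halfI_neq1 R))[].
Qed.

End ExecutionPathSpace.

(** * The base map of a weak S-homotopy equivalence *)

Section BaseMap.
Variables (R : realType) (X Y : topologicalType) (f : glob_morphism R X Y).
Hypothesis hf : weak_S_homotopy_equivalence f.
Variable h : X -> Y.
Local Notation I := (unit_interval R).
Let phi (x : X) (t : I) : I := height (f (glob_class x t)).
Hypothesis ch : continuous h.
Hypothesis rphi : forall x, is_reparam (phi x).
Hypothesis fE : forall x t, f (glob_class x t) = glob_class (h x) (phi x t).

Lemma continuous_height_morphism : continuous (fun z : X * I => phi z.1 z.2).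
Proof.
have [cf _ _] := glob_morphismP f.
apply: continuous_comp_fun; first exact: continuous_height.
apply: continuous_comp_fun => //.
by apply: continuous_glob_class; [exact: continuous_fst|exact: continuous_snd].
Qed.

Section AtPoint.
Variable x0 : X.
Let a : Glob R X := glob_class x0 I0.
Let b : Glob R X := glob_class x0 I1.

Let ha : height a = I0. Proof. exact: heightE. Qed.
Let hb : height b = I1. Proof. exact: heightE. Qed.
Let hfa : height (f a) = I0.
Proof. by rewrite fE heightE; have [] := rphi x0. Qed.
Let hfb : height (f b) = I1.
Proof. by rewrite fE heightE; have [] := rphi x0. Qed.

Let weq : weak_homotopy_equivalence R (exec_path_map f (alpha := a) (beta := b)).
Proof.
by have [_] := hf; apply; [left|right]; exists x0.
Qed.

Let csnd (T : topologicalType) : continuous (snd : T * I -> I).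
Proof. exact: continuous_snd. Qed.

Let is_reparam_snd (T : topologicalType) (z : T) :
  is_reparam (fun s : I => (z, s).2).
Proof. exact: is_reparam_id. Qed.

(** The section of the base-point projection given by paths whose height is the time. *)
Let straight (T : topologicalType) (y : T -> X) : T -> exec_path_space a b :=
  path_family ha hb y (@csnd T) (@is_reparam_snd T).

Let straight_val (T : topologicalType) (y : T -> X) z s :
  path_val (straight y z) s = glob_class (y z) s.
Proof. by []. Qed.

Let image_val gamma s :
  path_val (exec_path_map f (alpha := a) (beta := b) gamma) s = f (path_val gamma s).
Proof. by []. Qed.

Let continuous_straight (T : topologicalType) (y : T -> X) :
  compact [set: T] -> continuous y -> continuous (straight y).
Proof. by move=> cT cy; exact: continuous_path_family. Qed.

(* Over a homotopy H from h o g to h o g', the parametrisations of the image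
   paths are interpolated linearly. *)
Let lifted_homotopy (T : topologicalType) (g g' : T -> X) (H : T * I -> Y) :
  compact [set: T] -> continuous g -> continuous g' -> continuous H ->
  (forall v, H (v, I0) = h (g v)) -> (forall v, H (v, I1) = h (g' v)) ->
  exists P : T * I -> exec_path_space (f a) (f b), [/\ continuous P,
    forall v, P (v, I0) = exec_path_map f (straight g v),
    forall v, P (v, I1) = exec_path_map f (straight g' v) &
    forall v u x, g v = x -> g' v = x -> H (v, u) = h x ->
      P (v, u) = exec_path_map f (straight (fun _ : T => x) v)].
Proof.
move=> cT cg cg' cH H0 H1.
pose psi (x : T * I * I) := mix x.1.2 (phi (g x.1.1) x.2) (phi (g' x.1.1) x.2).
have c11 : continuous (fun x : T * I * I => x.1.1).
  by apply: continuous_comp_fun; exact: continuous_fst.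
have c12 : continuous (fun x : T * I * I => x.1.2).
  by apply: (continuous_comp_fun (@continuous_snd _ _)); exact: continuous_fst.
have cphi (k : T -> X) : continuous k ->
    continuous (fun x : T * I * I => phi (k x.1.1) x.2).
  move=> ck; apply: (continuous_comp_fun continuous_height_morphism
    (f := fun x : T * I * I => (k x.1.1, x.2))).
  apply: continuous_pair; last exact: continuous_snd.
  exact: continuous_comp_fun.
have cpsi : continuous psi by apply: continuous_mix => //; exact: cphi.
have rpsi z : is_reparam (fun s => psi (z, s)).
  by case: z => v u; exact: (is_reparam_mix u (rphi (g v)) (rphi (g' v))).
exists (path_family hfa hfb H cpsi rpsi); split.
- apply: continuous_path_family => //; rewrite -setXTT; apply: compact_setX => //.
  exact: compact_unit_interval.
- move=> v; apply: path_val_inj; apply/funext => s.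
  by rewrite path_family_val image_val straight_val H0 /psi mix0 -fE.
- move=> v; apply: path_val_inj; apply/funext => s.
  by rewrite path_family_val image_val straight_val H1 /psi mix1 -fE.
- move=> v u x gx g'x Hx; apply: path_val_inj; apply/funext => s.
  by rewrite path_family_val image_val straight_val Hx /psi /= gx g'x mixxx -fE.
Qed.

(** The projections intertwine composition with [f] and the base map [h], so homotopies between
    execution paths project to homotopies between points. *)
Let base_maps : exists (rX : exec_path_space a b -> X)
    (rY : exec_path_space (f a) (f b) -> Y), [/\ continuous rX, continuous rY,
  forall (T : topologicalType) (y : T -> X) z, rX (straight y z) = y z,
  forall gamma, rY (exec_path_map f gamma) = h (rX gamma) &
  forall gamma y (theta : I -> I),
    (forall s, path_val gamma s = glob_class y (theta s)) -> rY gamma = y].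
Proof.
have [rX [crX rXE rXu]] := @path_base R X a b.
have [rY [crY _ rYu]] := @path_base R Y (f a) (f b).
exists rX, rY; split=> //.
  by move=> T y z; apply: (rXu _ _ id).
move=> gamma; apply: (rYu _ _ (fun s => phi (rX gamma) (height (path_val gamma s)))).
by move=> s; rewrite -fE -rXE.
Qed.

(** The path in [Y] gives a path between the images of two straight paths; injectivity on components
    joins the straight paths, and projection joins their base points. *)
Lemma joined_of_image x1 : joined_by_path R (h x0) (h x1) -> joined_by_path R x0 x1.
Proof.
move=> [p [cp p0 p1]].
have [rX [rY [crX crY rXs rYm _]]] := base_maps.
have [_ [inj _] _] := weq.
(* The first factor is a dummy parameter, later set to [I0], so that the statement for families
   applies. *)
pose H (z : I * I) := p z.2.
have cH : continuous H by apply: continuous_comp_fun => //; exact: continuous_snd.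
have cc (x : X) : continuous (fun _ : I => x) by exact: continuous_cst_fun.
have [v|v|P [cP P0 P1 _]] :=
  lifted_homotopy (@compact_unit_interval R) (cc x0) (cc x1) cH.
- exact: p0.
- exact: p1.
have [|q [cq q0 q1]] :=
  inj (straight (fun _ : I => x0) I0) (straight (fun _ : I => x1) I0).
  by exists (fun t => P (I0, t)); split=> //; exact: continuous_slice.
exists (rX \o q); split; first exact: continuous_comp_fun.
- by rewrite /= q0 rXs.
- by rewrite /= q1 rXs.
Qed.

(** Straight paths make spheroids of [X] into spheroids of the path space; the homotopy is lifted
    there, transferred by injectivity for [f], and projected back to [X]. *)
Lemma spheroid_homotopic_of_image n (g g' : cube R n -> X) : (0 < n)%N ->
  is_spheroid x0 g -> is_spheroid x0 g' ->
  spheroid_homotopic (h x0) (h \o g) (h \o g') -> spheroid_homotopic x0 g g'.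
Proof.
move=> n0 [cg gb] [cg' g'b] [H [cH H0 H1 Hb]].
have [rX [rY [crX crY rXs rYm _]]] := base_maps.
have [_ _ /(_ n (straight (fun _ : X => x0) x0) n0)[inj _]] := weq.
have [P [cP P0 P1 Pb]] := lifted_homotopy (@compact_cube R n) cg cg' cH H0 H1.
have strE (T : topologicalType) (y : T -> X) z : y z = x0 ->
    straight y z = straight (fun _ : X => x0) x0.
  by move=> yz; apply: path_val_inj; apply/funext => s; rewrite !straight_val yz.
have [|||N [cN N0 N1 Nb]] := inj (straight g) (straight g').
- split; first by apply: continuous_straight => //; exact: compact_cube.
  by move=> v /gb gv; exact: strE.
- split; first by apply: continuous_straight => //; exact: compact_cube.
  by move=> v /g'b gv; exact: strE.
- exists P; split=> //.
  by move=> v t vb; rewrite (Pb v t x0) ?gb ?g'b ?Hb// (@strE _ (fun _ => x0)).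
exists (rX \o N); split.
- exact: continuous_comp_fun.
- by move=> v; rewrite /= N0 rXs.
- by move=> v; rewrite /= N1 rXs.
- by move=> v t vb; rewrite /= Nb// rXs.
Qed.

Lemma spheroid_lift n (w : cube R n -> Y) : (0 < n)%N -> is_spheroid (h x0) w ->
  exists2 g : cube R n -> X, is_spheroid x0 g & spheroid_homotopic (h x0) (h \o g) w.
Proof.
move=> n0 [cw wb].
have [rX [rY [crX crY rXs rYm rYu]]] := base_maps.
pose pt := straight (fun _ : X => x0) x0.
have [_ _ /(_ n pt n0)[_ surj]] := weq.
have cphi : continuous (fun z : cube R n * I => phi x0 z.2).
  apply: (@continuous_comp_fun _ _ _ (phi x0) snd); last exact: continuous_snd.
  exact: (@continuous_slice X I I _ x0 continuous_height_morphism).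
have rP (v : cube R n) : is_reparam (fun s => phi x0 (v, s).2) by exact: rphi.
(* The parametrisation is that of [f] over [x0], so that boundary points give exactly the image of
   the straight path over [x0]. *)
pose w' := path_family hfa hfb w cphi rP.
have [|g [cg gb] [N [cN N0 N1 Nb]]] := surj w'.
  split; first by apply: continuous_path_family => //; exact: compact_cube.
  move=> v vb; apply: path_val_inj; apply/funext => s.
  by rewrite path_family_val image_val straight_val wb// -fE.
exists (rX \o g).
  split; first exact: continuous_comp_fun.
  by move=> v vb; rewrite /= gb// rXs.
exists (rY \o N); split.
- exact: continuous_comp_fun.
- by move=> v; rewrite /= N0 /= rYm.
- move=> v; rewrite /= N1; apply: (rYu _ _ (phi x0)) => s; exact: erefl.
- by move=> v t vb; rewrite /= Nb// rYm rXs.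
Qed.

(** The straight path over [y] is joined to the image of some execution path; the base points along
    the way form the required path. *)
Lemma image_meets_component (y : Y) : exists x, joined_by_path R (h x) y.
Proof.
have [rX [rY [crX crY rXs rYm rYu]]] := base_maps.
have [_ [_ surj] _] := weq.
have idsnd : continuous (snd : I * I -> I) by exact: continuous_snd.
have rP (v : I) : is_reparam (fun s : I => (v, s).2) by exact: is_reparam_id.
have [gamma [q [cq q0 q1]]] := surj (path_family hfa hfb (fun _ : I => y) idsnd rP I0).
exists (rX gamma), (rY \o q); split.
- exact: continuous_comp_fun.
- by rewrite /= q0 rYm.
- by rewrite /= q1; apply: (rYu _ _ id) => s; exact: erefl.
Qed.

End AtPoint.

Lemma base_weak_equivalence : weak_homotopy_equivalence R h.
Proof.
split=> //; last first.
  move=> n x n0; split=> [g g'|w]; first exact: spheroid_homotopic_of_image.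
  exact: spheroid_lift.
split; first by move=> x x'; exact: joined_of_image.
move=> y; have [[_ _ sub] _] := hf.
(* A point of [X] is needed to form path spaces. Surjectivity on the 0-skeletons provides one as
   soon as [Y] has a point. *)
have [|z sz _] := sub (glob_class y I0); first by left; exists y.
by case: sz => -[x _ _]; exact: (image_meets_component x).
Qed.

End BaseMap.

(** * The globe of a map and the S-homotopy inverse *)

(** The choice of a representative is harmless because heights are kept and the base point does not
    matter at the poles. *)
Lemma glob_suspension (R : realType) (X Y : topologicalType) (k : Y -> X) :
  continuous k -> exists g : glob_morphism R Y X,
    forall y t, g (glob_class y t) = glob_class (k y) t.
Proof.
move=> ck; pose g (z : Glob R Y) : Glob R X := glob_class (k (repr z).1) (height z).
have gE y t : g (glob_class y t) = glob_class (k y) t.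
  rewrite /g; have /glob_classP := glob_class_repr (glob_class y t).
  set y' := (repr _).1; rewrite heightE => -[[->//]|[-> _]|[-> _]].
    by apply/glob_classP; constructor 2.
  by apply/glob_classP; constructor 3.
have gP : is_glob_morphism g.
  apply: (glob_morphism_class (a := k) (phi := fun _ => id)) => //.
  apply: continuous_from_glob; under eq_fun do rewrite gE.
  apply: continuous_glob_class; last exact: continuous_snd.
  by apply: continuous_comp_fun => //; exact: continuous_fst.
by exists (GlobMorphism gP).
Qed.

Theorem proposition5p13 (R : realType) (X Y : topologicalType)
    (hX : cw_complex R X) (hY : cw_complex R Y)
    (cX : connected [set: X]) (cY : connected [set: Y])
    (f : glob_morphism R X Y) (hf : weak_S_homotopy_equivalence f) :
  exists g : glob_morphism R Y X,
    S_homotopic (g \o f) idfun /\ S_homotopic (f \o g) idfun.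
Proof.
have [h [ch rphi fE]] := glob_morphism_decomposition f.
have wh := base_weak_equivalence hf ch rphi fE.
have [k [K1 [K2 [ck cK1 cK2 K1E K2E]]]] := whitehead wh hX hY.
have [g gE] := glob_suspension R ck.
have cphi := @continuous_height_morphism R X Y f.
exists g; split.
  (* Since [g] keeps heights, the composite has the parametrisation of [f]. *)
  apply: (@S_homotopic_class _ _ _ (k \o h)
    (fun x t => height (f (glob_class x t))) K1) => //.
  by move=> x t; rewrite /= {1}fE gE.
(* Here the parametrisation over [y] is that of [f] over [k y]. *)
apply: (@S_homotopic_class _ _ _ (h \o k)
  (fun y t => height (f (glob_class (k y) t))) K2) => //.
  apply: (continuous_comp_fun cphi (f := fun z => (k z.1, z.2))).
  apply: continuous_pair; last exact: continuous_snd.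
  by apply: continuous_comp_fun => //; exact: continuous_fst.
by move=> y t; rewrite /= gE; exact: fE.
Qed.
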